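(* A tree of local models $(\mathcal{F},\mathcal{X})$ is uniquely determined by its first-return map on its spine $(\mathcal{R},\mathcal{S})$: if $(\mathcal{F}_1,\mathcal{X}_1)$ and $(\mathcal{F}_2,\mathcal{X}_2)$ are trees of local models whose spines with first-return maps $(\mathcal{R}_1,\mathcal{S}_1)$ and $(\mathcal{R}_2,\mathcal{S}_2)$ are isomorphic, then $(\mathcal{F}_1,\mathcal{X}_1)$ and $(\mathcal{F}_2,\mathcal{X}_2)$ are equivalent.
   Context: Polynomial trees. A polynomial tree is a pair $(F,T)$ where $T$ is a locally finite, connected, $1$-dimensional simplicial complex without cycles and $F:T\to T$ is a simplicial map such that: (1) $T$ has no vertices of valence $1$; (2) $T$ has a unique isolated end ($\infty$; ''above'' means toward $\infty$); (3) $F$ is proper, open and continuous; (4) the grand orbit of every vertex contains a vertex of valence $\ge3$, where $x,y$ lie in the same grand orbit if $F^m(x)=F^n(y)$ for some positive integers $m,n$; (5) there is a local degree function $\deg$ on edges and vertices, with positive integer values, such that at each vertex $v$, with $E_v$ the set of edges adjacent to $v$, $\deg(v)=\sum_{e\in E_v,\,F(e)=F(e')}\deg(e)$ for every $e'\in E_v$ and $2\deg(v)-2\ge\sum_{e\in E_v}(\deg(e)-1)$. (The degree function is unique; the degree of $F$ is $d=\max_v\deg(v)$, assumed $\ge2$.) A critical point of $(F,T)$ is a vertex where the last inequality is strict. A height metric is a metric linear on edges with $|F(e)|=d\,|e|$; its height function $h$ is the distance to the set of non-isolated ends. $(F,T,h)$ is a metrized polynomial tree. Let $v_0$ be the highest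 vertex of valence $>2$. For a vertex $v$ the level $l(v)$ is the least $l\ge0$ with $h(F^l(v))\ge h(v_0)$, and the weight is $\mu(v)=d^{-l(v)}\prod_{i=0}^{l(v)-1}\deg(F^i(v))$. The spine $S(T)$ is the convex hull of the critical points and critical ends, i.e. the connected subtree consisting of all edges of degree $>1$. Local models. Let $-\infty\le h_{min}<c_0<h_{max}\le\infty$ and $R=\{x+iy:0<x<2\pi,\,h_{min}<y<h_{max}\}$ minus a finite union of vertical slits $\{x=x_j,\ h_{min}<y\le c_0\}$. A local model surface $(X,\omega)$ is a planar Riemann surface $X$ obtained from $R$ by identifying pairs of vertical edges by horizontal translations, with $\omega$ the $1$-form given by $dz$. The $y$-coordinate gives a height function; the central leaf is the level set at height $c_0$; its complement consists of one outer annulus (above) and finitely many inner annuli (below). A local model map is a holomorphic branched cover $f:(Y,\eta)\to(X,\omega)$ of local model surfaces with $\eta=\frac1{\deg f}f^*\omega$ sending central leaf to central leaf. Trees of local models. A tree of local models over $(F,T,h)$ is a collection $\{(f_v,(X_v,\omega_v),\pi_v)\}$ indexed by vertices $v$ of $T$, such that for each $v$, with $T_v$ its star: (1) $(X_v,\omega_v)$ is a local model surface and $\pi_v$ is a homeomorphism onto $T_v$ from the quotient tree of $X_v$ obtained by collapsing each leaf of the horizontal foliation of $\omega_v$ to a point (outer annulus to the edge above $v$), which is an isometry from the metric induced by $\mu(v)|\omega_v|$ to the height metric; (2) $f_v:(X_v,\omega_v)\to(X_{F(v)},\omega_{F(v)})$ is a local model map which, via the markings, induces $F:T_v\to T_{F(v)}$,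 and whose local degrees on leaves agree with the local degree function on $T_v$. Put $\mathcal{X}=\bigsqcup_vX_v$ and let $\mathcal{F}:\mathcal{X}\to\mathcal{X}$ be given by the $f_v$. Two trees of local models are equivalent if there is a holomorphic isometry $i:\mathcal{X}_1\to\mathcal{X}_2$ (for the metrics $|\omega_v|$) with $\mathcal{F}_2\circ i=i\circ\mathcal{F}_1$ that induces via the markings an isometry of the underlying trees conjugating $F_1$ to $F_2$. Spine of a tree of local models. $\mathcal{S}\subset\mathcal{X}$ is the union of the $X_v$ over vertices $v\in S(T)$, and $\mathcal{R}:\mathcal{S}\to\mathcal{S}$ is given on $X_v$ by $\mathcal{R}|_{X_v}=\mathcal{F}^{s(v)}:X_v\to X_{F^{s(v)}(v)}$ with $s(v)=\min\{i>0:F^i(v)\in S(T)\}$. An isomorphism $(\mathcal{R}_1,\mathcal{S}_1)\to(\mathcal{R}_2,\mathcal{S}_2)$ is a holomorphic isometry $\mathcal{S}_1\to\mathcal{S}_2$ conjugating $\mathcal{R}_1$ to $\mathcal{R}_2$ and respecting the underlying tree structure (inducing via the markings an isometry between the unions of the stars of the vertices of $S(T_1)$ and of $S(T_2)$). *)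

(* Defs.v *)
From HB Require Import structures.
From Stdlib Require Import Relation_Operators.
From mathcomp Require Import all_boot all_order all_algebra all_fingroup.
From mathcomp Require Import finmap.
From mathcomp Require Import complex.
From mathcomp Require Import all_classical all_reals all_analysis.

Set Implicit Arguments.
Unset Strict Implicit.
Unset Printing Implicit Defensive.

Import Order.TTheory GRing.Theory Num.Theory.
Import numFieldNormedType.Exports.

Local Open Scope fset_scope.
Local Open Scope classical_set_scope.
Local Open Scope ring_scope.

Section PathMetric.
Variables (R : realType) (X : Type) (step : X -> X -> R -> Prop).

Inductive chain : X -> X -> R -> Prop :=
| chain_nil x : chain x x 0
| chain_cons x y z c l : step x y c -> chain y z l -> chain x z (c + l).

Definition chain_dist (x y : X) : R := inf [set l | chain x y l].

End PathMetric.

Record graph := Graph {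
  vtx :> choiceType;
  nbr : vtx -> {fset vtx};
  nbr_sym : forall v w, w \in nbr v -> v \in nbr w;
  nbr_irr : forall v, v \notin nbr v }.

Section Graph.
Variable T : graph.

Definition adj : rel T := fun v w => w \in nbr v.

Definition valence (v : T) : nat := #|` nbr v|.

Definition graph_connected : Prop :=
  inhabited T /\ forall v w : T, exists2 p, path adj v p & last v p = w.

Definition acyclic : Prop :=
  forall p : seq T, (2 < size p)%N -> ~ ucycle adj p.

(* In an acyclic graph a ray is a geodesic ray.  Ends are rays up to
   [same_end]; the end of [r] is isolated when some initial segment of [r]
   determines it among the rays starting at [r 0]. *)
Definition ray (r : nat -> T) : Prop :=
  injective r /\ forall n, r n.+1 \in nbr (r n).

Definition same_end (r r' : nat -> T) : Prop :=
  exists m n, forall k, r (m + k)%N = r' (n + k)%N.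

Definition isolated_end (r : nat -> T) : Prop :=
  exists n, forall r', ray r' -> (forall i, (i <= n)%N -> r' i = r i) ->
    forall i, r' i = r i.

Definition above (v w : T) : Prop :=
  exists r, [/\ ray r, isolated_end r, r 0%N = v & r 1%N = w].

Definition simplex (u w : T) : Prop := w = u \/ w \in nbr u.

Variable R : realType.

Definition bary (u w : T) (t : R) : T -> R :=
  fun v => (1 - t) * (v == u)%:R + t * (v == w)%:R.

(* Points of the realization are given by their barycentric coordinates. *)
Record geo := Geo {
  coord : T -> R;
  coordP : exists u w t, [/\ simplex u w, 0 <= t <= 1 & coord = bary u w t] }.

HB.instance Definition _ := gen_eqMixin geo.
HB.instance Definition _ := gen_choiceMixin geo.

Definition on_simplex (u w : T) (t : R) (x : geo) : Prop :=
  [/\ simplex u w, 0 <= t <= 1 & coord x = bary u w t].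

(* The weak topology: a set is open iff its trace on each simplex is. *)
Definition geo_open : set_system geo := [set U |
  forall u w t x, on_simplex u w t x -> U x ->
  exists2 e : R, 0 < e & forall t' y, on_simplex u w t' y -> `|t' - t| < e ->
  U y].

Lemma geo_openT : geo_open setT.
Proof. by move=> u w t x _ _; exists 1. Qed.

Lemma geo_openI : setI_closed geo_open.
Proof.
move=> A B oA oB u w t x xt [Ax Bx].
have [e e0 He] := oA _ _ _ _ xt Ax; have [e' e0' He'] := oB _ _ _ _ xt Bx.
exists (Num.min e e'); first by rewrite lt_min e0.
by move=> t' y yt; rewrite lt_min => /andP[? ?]; split; [apply: He yt _|apply: He' yt _].
Qed.

Lemma geo_open_bigU (I : Type) (f : I -> set geo) :
  (forall i, geo_open (f i)) -> geo_open (\bigcup_i f i).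
Proof.
move=> of_ u w t x xt [i _ fx]; have [e e0 He] := of_ i _ _ _ _ xt fx.
by exists e => // t' y yt tt'; exists i => //; apply: He yt tt'.
Qed.

HB.instance Definition _ :=
  isOpenTopological.Build geo geo_openT geo_openI geo_open_bigU.

Definition is_vertex (v : T) (x : geo) : Prop := coord x v = 1.

(* The open star: [v] and the open edges adjacent to it. *)
Definition star (v : T) : set geo := [set x | 0 < coord x v].

Definition edge_metric_step (len : T -> T -> R) (x y : geo) (c : R) : Prop :=
  exists u w t t', [/\ w \in nbr u, on_simplex u w t x, on_simplex u w t' y &
    c = len u w * `|t - t'|].

End Graph.

Definition simplicial (T T' : graph) (F : T -> T') : Prop :=
  forall u w, simplex u w -> simplex (F u) (F w).

Section GeoMap.
Variables (T T' : graph) (R : realType) (F : T -> T').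
Hypothesis simpF : simplicial F.

Let push (x : geo T R) : T' -> R :=
  fun y => \sum_(v \in [set v | F v = y]) coord x v.

Lemma push_bary u w t x : coord x = bary u w t -> push x = bary (F u) (F w) t.
Proof.
move=> xE; apply/funext => y.
rewrite /push xE (fsbigE [seq v <- undup [:: u; w] | F v == y]).
- have memE v : (v \in [set v | F v = y]) = (F v == y).
    by apply/idP/eqP; rewrite inE.
  rewrite big_filter_cond /bary /= !(eq_sym y); have [<-|uw] := eqVneq u w.
    rewrite mem_seq1 eqxx /= big_cons big_nil memE andbb eqxx.
    by case: (F u == y); rewrite ?mulr0 ?addr0.
  rewrite mem_seq1 (negbTE uw) !big_cons big_nil !memE !andbb !eqxx.
  rewrite (eq_sym w u) (negbTE uw).
  by case: (F u == y); case: (F w == y); rewrite !(mulr0, mulr1, addr0, add0r).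
- by rewrite filter_uniq ?undup_uniq.
- by move=> v /=; rewrite mem_filter => /andP[/eqP].
- move=> v Fvy; rewrite mem_filter (introT eqP Fvy) andTb mem_undup.
  rewrite !inE negb_or /bary.
  by case/andP=> /negbTE-> /negbTE->; rewrite !mulr0 addr0.
Qed.

Lemma pushP x : exists u w t,
  [/\ simplex u w, 0 <= t <= 1 & push x = bary u w t].
Proof.
have [u [w [t [uw t01 xE]]]] := coordP x.
exists (F u), (F w), t; split => //; first exact: simpF.
exact: push_bary.
Qed.

(* The affine extension of a simplicial map. *)
Definition geo_map (x : geo T R) : geo T' R := Geo (pushP x).

End GeoMap.

Record ptree (R : realType) := PTree {
  tree :> graph;
  tree_connected : graph_connected tree;
  tree_acyclic : acyclic tree;
  tmap : tree -> tree;
  tmap_simplicial : simplicial tmap;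
  valence_neq1 : forall v : tree, valence v <> 1%N;
  isolated_end_ex : exists r : nat -> tree, ray r /\ isolated_end r;
  isolated_end_unique : forall r r' : nat -> tree, ray r -> isolated_end r ->
    ray r' -> isolated_end r' -> same_end r r';
  tmap_proper : forall K : set (geo tree R), compact K ->
    compact (geo_map tmap_simplicial @^-1` K);
  tmap_open : forall U : set (geo tree R), open U ->
    open (geo_map tmap_simplicial @` U);
  tmap_continuous : continuous (geo_map (R := R) tmap_simplicial);
  grand_orbit_branches : forall v : tree, exists w m n,
    [/\ (2 < valence w)%N, (0 < m)%N, (0 < n)%N & iter m tmap v = iter n tmap w];
  vdeg : tree -> nat;
  (* [edeg v w] is the degree of the edge joining [v] to [w], if there is one *)
  edeg : tree -> tree -> nat;
  vdeg_gt0 : forall v, (0 < vdeg v)%N;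
  edeg_gt0 : forall v w, w \in nbr v -> (0 < edeg v w)%N;
  edeg_sym : forall v w, w \in nbr v -> edeg v w = edeg w v;
  (* as [tmap] is simplicial, the edges from [v] to [w] and to [w'] have the same
     image iff [tmap w = tmap w'] *)
  vdegE : forall v w', w' \in nbr v ->
    vdeg v = (\sum_(w <- nbr v | tmap w == tmap w') edeg v w)%N;
  edeg_ramification : forall v,
    (\sum_(w <- nbr v) (edeg v w - 1) <= 2 * vdeg v - 2)%N;
  degree : nat;
  vdeg_le_degree : forall v, (vdeg v <= degree)%N;
  degree_attained : exists v, vdeg v = degree;
  degree_gt1 : (1 < degree)%N }.

(* A height metric is given by the lengths [len v w] of the edges. *)
Record mptree (R : realType) := MPTree {
  mtree :> ptree R;
  len : mtree -> mtree -> R;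
  len_gt0 : forall v w, w \in nbr v -> 0 < len v w;
  len_sym : forall v w, w \in nbr v -> len v w = len w v;
  len_tmap : forall v w, w \in nbr v ->
    len (tmap v) (tmap w) = (degree mtree)%:R * len v w }.

Section MetrizedTree.
Variables (R : realType) (T : mptree R).

Definition tree_pt := geo T R.

Definition tree_map : tree_pt -> tree_pt := geo_map (tmap_simplicial (p := T)).

Definition tree_dist : tree_pt -> tree_pt -> R :=
  chain_dist (edge_metric_step (len (m := T))).

(* The distance to the set of non-isolated ends. *)
Definition height (v : T) : \bar R := ereal_inf [set L |
  exists r : nat -> T, [/\ ray r, ~ isolated_end r, r 0%N = v &
    L = (\sum_(0 <= n <oo) (len (r n) (r n.+1))%:E)%E]].

Definition highest_branch (v : T) : Prop :=
  (2 < valence v)%N /\ forall w : T, (2 < valence w)%N -> (height w <= height v)%E.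

Definition reaches_top (v : T) (l : nat) : Prop :=
  exists2 v0 : T, highest_branch v0 &
    (height v0 <= height (iter l (tmap (p := T)) v))%E.

Definition level (v : T) : nat := xget 0%N [set l |
  reaches_top v l /\ forall m, (m < l)%N -> ~ reaches_top v m].

Definition weight (v : T) : R :=
  (degree T)%:R ^- level v *
  \prod_(i < level v) (vdeg (iter i (tmap (p := T)) v))%:R.

(* The vertices of the union of the edges of degree > 1. *)
Definition in_spine (v : T) : Prop := exists2 w, w \in nbr v & (1 < edeg v w)%N.

Definition return_time (v : T) : nat := xget 0%N [set s |
  [/\ (0 < s)%N, in_spine (iter s (tmap (p := T)) v) &
      forall i, (0 < i < s)%N -> ~ in_spine (iter i (tmap (p := T)) v)]].

Definition spine_stars : set tree_pt := \bigcup_(v in in_spine) star (T := T) v.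

End MetrizedTree.

(* [R[i]] as a [numFieldType], so that it carries its normed topology and
   [derivable f z 1], ['D_1 f z] are complex differentiability and the complex
   derivative. *)
Definition C (R : realType) : numFieldType := R[i].

Section Charts.
Variables (R : realType) (X : topologicalType).

(* The values of [cmap] outside [cdom], and of [cinv] outside the image of
   [cdom], are irrelevant. *)
Record chart := Chart { cdom : set X; cmap : X -> C R; cinv : C R -> X }.

Definition is_chart (phi : chart) : Prop :=
  [/\ open (cdom phi), open (cmap phi @` cdom phi),
      {in cdom phi, cancel (cmap phi) (cinv phi)},
      {in cdom phi, continuous (cmap phi)} &
      {in cmap phi @` cdom phi, continuous (cinv phi)}].

Definition chart_compat (phi psi : chart) : Prop :=
  forall x, cdom phi x -> cdom psi x ->
  derivable (cmap psi \o cinv phi) (cmap phi x) 1.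

End Charts.

Record surface (R : realType) := Surface {
  carrier :> topologicalType;
  atlas : set (chart R carrier);
  surface_hausdorff : hausdorff_space carrier;
  surface_connected : connected [set: carrier];
  atlas_chart : forall phi, atlas phi -> is_chart phi;
  atlas_cover : forall x, exists2 phi, atlas phi & cdom phi x;
  atlas_compat : forall phi psi, atlas phi -> atlas psi -> chart_compat phi psi;
  atlas_maximal : forall phi, is_chart phi ->
    (forall psi, atlas psi -> chart_compat phi psi /\ chart_compat psi phi) ->
    atlas phi }.

(* [coef phi] is the function [a] such that the form is [a(z) dz] in the
   coordinate [z] of the chart [phi]. *)
Record form (R : realType) (X : surface R) := Form {
  coef : chart R X -> C R -> C R;
  coef_holo : forall phi x, atlas phi -> cdom phi x ->
    derivable (coef phi) (cmap phi x) 1;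
  coef_change : forall phi psi x, atlas phi -> atlas psi ->
    cdom phi x -> cdom psi x ->
    coef phi (cmap phi x) =
    coef psi (cmap psi x) * 'D_1 (cmap psi \o cinv phi) (cmap phi x) }.

Section Maps.
Variables (R : realType) (X Y : surface R).
Implicit Types (f : X -> Y) (phi : chart R X) (psi : chart R Y).

Definition in_charts f phi psi : C R -> C R := cmap psi \o f \o cinv phi.

Definition charts_at f (x : X) phi psi : Prop :=
  [/\ atlas phi, cdom phi x, atlas psi & cdom psi (f x)].

Definition holomorphic f : Prop := continuous f /\
  forall x phi psi, charts_at f x phi psi ->
  derivable (in_charts f phi psi) (cmap phi x) 1.

Definition pullback_coef f (om : form Y) (x : X) phi psi : C R :=
  coef om psi (cmap psi (f x)) * 'D_1 (in_charts f phi psi) (cmap phi x).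

Definition mult_at f (x : X) (m : nat) : Prop :=
  (0 < m)%N /\ exists phi psi, [/\ charts_at f x phi psi,
    cmap phi x = 0, cmap psi (f x) = 0 &
    \forall x' \near x, cmap psi (f x') = cmap phi x' ^+ m].

(* The points of [A] in the fibre of [f] over [y] are finitely many, and
   there are [n] of them counted with multiplicity. *)
Definition fiber_count f (A : set X) (y : Y) (n : nat) : Prop :=
  exists (s : seq X) (m : X -> nat),
    [/\ uniq s, forall x, x \in s <-> A x /\ f x = y,
        forall x, x \in s -> mult_at f x (m x) & (\sum_(x <- s) m x)%N = n].

Definition branched_cover f (n : nat) : Prop :=
  [/\ (0 < n)%N, holomorphic f & forall y, fiber_count f setT y n].

End Maps.

Definition holo_isometry (R : realType) (X Y : surface R) (eta : form X)
    (om : form Y) (f : X -> Y) : Prop :=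
  (exists g : Y -> X,
    [/\ cancel f g, cancel g f, holomorphic f & holomorphic g]) /\
  forall x phi psi, charts_at f x phi psi ->
    `|pullback_coef f om x phi psi| = `|coef eta phi (cmap phi x)|.

Section SlitRectangle.
Variables (R : realType) (hmin : \bar R) (c0 : R) (hmax : \bar R).
Variables (k : nat) (xs : nat -> R) (tau : 'S_k.+1).

(* The slits are at the abscissas [xs 1 < .. < xs k]; cutting the rectangle
   along the vertical lines through them gives [k.+1] strips, here taken with
   their vertical sides.  The right side of the strip [j] is reglued to the
   left side of the next one above [c0].  From [c0] down, it is the left bank
   of a slit, and is glued to the right bank of the slit given by [tau]: for
   [dz] to descend, a left bank has to be paired with a right bank.  The index
   [0] stands for the two sides of the rectangle, glued to each other, so that
   [tau 0 = 0] is required below.  All slit tops over a cycle of [tau] become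
   one point. *)
Definition strip (j : 'I_k.+1) : set (C R) := [set z |
  [/\ xs j <= complex.Re z <= xs j.+1, (hmin < (complex.Im z)%:E)%E &
      ((complex.Im z)%:E < hmax)%E]].

Definition strip_interior (j : 'I_k.+1) : set (C R) := [set z |
  strip j z /\ xs j < complex.Re z < xs j.+1].

Definition glue (p p' : 'I_k.+1 * C R) : Prop :=
  [/\ strip p.1 p.2, strip p'.1 p'.2,
      complex.Im p.2 = complex.Im p'.2,
      complex.Re p.2 = xs p.1.+1 /\ complex.Re p'.2 = xs p'.1 &
      (c0 <= complex.Im p.2 /\ p'.1 = ordS p.1) \/
      (complex.Im p.2 <= c0 /\ p'.1 = tau (ordS p.1))].

End SlitRectangle.

Record local_model (R : realType) := LocalModel {
  lm_surface :> surface R;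
  lm_form : form lm_surface;
  lm_hmin : \bar R;
  lm_c0 : R;
  lm_hmax : \bar R;
  lm_hmin_lt : (lm_hmin < lm_c0%:E)%E;
  lm_hmax_gt : (lm_c0%:E < lm_hmax)%E;
  lm_slits : nat;
  lm_xs : nat -> R;
  lm_xs0 : lm_xs 0%N = 0;
  lm_xs_last : lm_xs lm_slits.+1 = 2 * pi;
  lm_xs_lt : forall j, (j <= lm_slits)%N -> lm_xs j < lm_xs j.+1;
  lm_pairing : 'S_lm_slits.+1;
  lm_pairing0 : lm_pairing ord0 = ord0;
  lm_proj : 'I_lm_slits.+1 -> C R -> lm_surface;
  lm_strip := strip lm_hmin lm_hmax (k := lm_slits) lm_xs;
  lm_proj_surj : forall p, exists j z, lm_strip j z /\ lm_proj j z = p;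
  lm_proj_eq : forall j z j' z', lm_strip j z -> lm_strip j' z' ->
    (lm_proj j z = lm_proj j' z' <->
     clos_refl_sym_trans _ (glue lm_hmin lm_c0 lm_hmax lm_xs lm_pairing)
       (j, z) (j', z'));
  lm_proj_quotient : forall U : set lm_surface, open U <->
    forall j, exists2 V : set (C R), open V &
      lm_strip j `&` lm_proj j @^-1` U = lm_strip j `&` V;
  (* The projection is holomorphic and pulls the form back to [dz].  Inside the
     strips is enough: the primitives of the form extend continuously across
     the images of the sides, which determines the structure there. *)
  lm_proj_form : forall j z phi,
    strip_interior lm_hmin lm_hmax lm_xs j z ->
    atlas phi -> cdom phi (lm_proj j z) ->
    derivable (cmap phi \o lm_proj j) z 1 /\
    coef lm_form phi (cmap phi (lm_proj j z)) *
      'D_1 (cmap phi \o lm_proj j) z = 1;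
  (* Planarity: being noncompact, the surface embeds in the plane. *)
  lm_planar : exists g : lm_surface -> C R, [/\ injective g, continuous g &
    forall U, open U -> open (g @` U)];
  lm_y : lm_surface -> R;
  lm_yE : forall j z, lm_strip j z -> lm_y (lm_proj j z) = complex.Im z }.

Section LocalModel.
Variables (R : realType) (X : local_model R).

Definition central_leaf : set X := [set p | lm_y p = lm_c0 X].

Definition leaf (p : X) : set X :=
  connected_component [set p' | lm_y p' = lm_y p] p.

(* [leaf_dist] is the pseudometric on the quotient by the leaves induced by the
   metric [|dz|]: moving inside a leaf costs nothing. *)
Definition leaf_step (p p' : X) (c : R) : Prop :=
  (exists j z z', [/\ @lm_strip R X j z, @lm_strip R X j z',
     p = lm_proj j z, p' = lm_proj j z' & c = complex.Re `|z - z'|]) \/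
  (leaf p p' /\ c = 0).

Definition leaf_dist : X -> X -> R := chain_dist leaf_step.

End LocalModel.

Arguments central_leaf {R} X.

Definition local_model_map (R : realType) (Y X : local_model R) (f : Y -> X) :
    Prop :=
  exists n, [/\ branched_cover f n,
    forall y phi psi, charts_at f y phi psi ->
      coef (lm_form Y) phi (cmap phi y) =
      n%:R^-1 * pullback_coef f (lm_form X) y phi psi &
    f @` central_leaf Y = central_leaf X].

Record tree_of_local_models (R : realType) (T : mptree R) := TLM {
  model : T -> local_model R;
  marking : forall v, model v -> tree_pt T;
  model_map : forall v, model v -> model (tmap v);
  (* [marking v] identifies the leaf space of [model v] with the star of [v] *)
  marking_star : forall v, @marking v @` setT = star v;
  marking_leaf : forall v (p p' : model v),
    marking p = marking p' <-> leaf p p';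
  marking_homeo : forall v (U : set (tree_pt T)), U `<=` star v ->
    (open U <-> open (@marking v @^-1` U));
  marking_outer : forall v w (p : model v), above v w ->
    (lm_c0 (model v) < lm_y p <-> star w (marking p));
  marking_isometry : forall v (p p' : model v),
    tree_dist (marking p) (marking p') = weight v * leaf_dist p p';
  model_map_local : forall v, local_model_map (@model_map v);
  model_map_marking : forall v (p : model v),
    marking (model_map p) = tree_map (marking p);
  model_map_vdeg : forall v (p : model v), is_vertex v (marking p) ->
    fiber_count (@model_map v) (leaf p) (model_map p) (vdeg v);
  model_map_edeg : forall v w (p : model v), w \in nbr v ->
    star w (marking p) ->
    fiber_count (@model_map v) (leaf p) (model_map p) (edeg v w) }.

Section Total.
Variables (R : realType) (T : mptree R) (M : tree_of_local_models T).

Definition total := {v : T & model M v}.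

Definition total_map (p : total) : total :=
  existT _ (tmap (tag p)) (model_map (tagged p)).

Definition total_marking (p : total) : tree_pt T := marking (tagged p).

Definition over (A : set T) : set total := [set p | A (tag p)].

Definition first_return (p : total) : total :=
  iter (return_time (tag p)) total_map p.

End Total.

(* [i] restricts to a holomorphic isometry from the disjoint union of the
   [model M1 v], [v] in [A1], to that of the [model M2 w], [w] in [A2].  As
   the pieces are connected, it maps each one onto another. *)
Definition total_isometry (R : realType) (T1 T2 : mptree R)
    (M1 : tree_of_local_models T1) (M2 : tree_of_local_models T2)
    (A1 : set T1) (A2 : set T2) (i : total M1 -> total M2) : Prop :=
  set_bij (over A1) (over A2) i /\
  forall v, A1 v -> exists (w : T2) (g : model M1 v -> model M2 w),
    holo_isometry (lm_form (model M1 v)) (lm_form (model M2 w)) g /\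
    forall p, i (existT _ v p) = existT _ w (g p).

Definition equivalent (R : realType) (T1 T2 : mptree R)
    (M1 : tree_of_local_models T1) (M2 : tree_of_local_models T2) : Prop :=
  exists i : total M1 -> total M2,
    [/\ total_isometry setT setT i,
        forall p, total_map (i p) = i (total_map p) &
        exists sigma : tree_pt T1 -> tree_pt T2,
          [/\ bijective sigma,
              forall x y, tree_dist (sigma x) (sigma y) = tree_dist x y,
              forall p, total_marking (i p) = sigma (total_marking p) &
              forall x, tree_map (sigma x) = sigma (tree_map x)]].

(* Only the values of [i] over the spine and of [sigma] on the stars of its
   vertices are relevant. *)
Definition spine_isomorphic (R : realType) (T1 T2 : mptree R)
    (M1 : tree_of_local_models T1) (M2 : tree_of_local_models T2) : Prop :=
  exists i : total M1 -> total M2,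
    [/\ total_isometry (@in_spine R T1) (@in_spine R T2) i,
        forall p, over (@in_spine R T1) p ->
          first_return (i p) = i (first_return p) &
        exists sigma : tree_pt T1 -> tree_pt T2,
          [/\ set_bij (@spine_stars R T1) (@spine_stars R T2) sigma,
              forall x y, spine_stars x -> spine_stars y ->
                tree_dist (sigma x) (sigma y) = tree_dist x y &
              forall p, over (@in_spine R T1) p ->
                total_marking (i p) = sigma (total_marking p)]].

(* Main.v *)
Require Import Defs.
From mathcomp Require Import all_boot all_order all_algebra.
From mathcomp Require Import finmap complex.
From mathcomp Require Import all_classical all_reals all_analysis.
From mathcomp Require Import zify ring lra.

(** The parent of a vertex is its neighbour towards the isolated end.  The map
    commutes with taking parents: otherwise some descending ray would be sent
    onto a ray to infinity, and a degree count along it (finitely many merges,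
    because the map is proper, and then a drop of the edge degree at each
    branching) would make that ray isolated as well.  Hence the map shifts the
    Busemann function of the isolated end by a constant, which is positive, the
    spine is closed under taking parents, and off the spine the map is injective
    on stars and a holomorphic isometry on local models.

    An isomorphism of spines induces a bijection between the vertices whose
    parent is in the spine.  It extends, by descending induction on the Busemann
    function, to a unique tree isomorphism [phi] commuting with the maps: below a
    vertex [w] off the spine, a child [v] goes to the child of [phi w] that the
    map sends to the image under [phi] of the image of [v]; below a spine vertex,
    the first-return map forces compatibility, because all but the first step of
    the return is injective on stars.  Over a vertex [v], the equivalence is then obtained by moving to the
    first iterate in the spine and coming back by the inverse isometry. *)

Set Implicit Arguments.
Unset Strict Implicit.
Unset Printing Implicit Defensive.

Import Order.TTheory GRing.Theory Num.Theory.
Import numFieldNormedType.Exports.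

Local Open Scope classical_set_scope.

(** * Rays in an acyclic graph *)

Local Open Scope nat_scope.

(** The data are topological and metric, the argument is combinatorial, and the translation shapes
    the proof. Openness of the tree map makes it send edges to edges and stars onto stars;
    properness makes vertex fibres finite. The map of tree points that comes with an isomorphism of
    spines is only known to be an isometry on the stars of spine vertices, compatible with markings.
    To read it as a map of vertices and edges, distances inside a star are computed exactly, with
    1-Lipschitz functions bounding the infimum over chains from below. Edges are then followed
    through their point of parameter 1/3, whose unequal coordinates name the two ends in order.
    Orbits and lines of parents both climb, so in the descending induction everything the
    construction refers to is already known. Lengths away from the spine are recovered from the
    factor [degree] between an edge and its image. *)

Lemma cycle_mkseq (X : Type) (e : rel X) (s : nat -> X) n :
  (forall k, k < n -> e (s k) (s k.+1)) -> e (s n) (s 0) -> cycle e (mkseq s n.+1).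
Proof.
move=> se sn.
have lastE m : last (s 0) [seq s k | k <- iota 1 m] = s m.
  by case: m => [//|m]; rewrite -[m.+1]addn1 iotaD map_cat last_cat /= add1n addn1.
rewrite /mkseq /= rcons_path lastE sn andbT.
elim: n {sn} se => [//|n IH] se; rewrite -[n.+1]addn1 iotaD map_cat cat_path.
rewrite lastE /= andbT add1n se // IH // => k kn; apply: se; exact: ltnW.
Qed.

Section Rays.
Variable T : graph.
Hypothesis acyT : acyclic T.

Definition walk (r : nat -> T) := forall n, r n.+1 \in nbr (r n).

Lemma nbrC (v w : T) : (w \in nbr v) = (v \in nbr w).
Proof. by apply/idP/idP; apply: nbr_sym. Qed.

Lemma nbr_neq (v w : T) : w \in nbr v -> w <> v.
Proof. by move=> wv e; move: wv; rewrite e (negbTE (nbr_irr v)). Qed.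

(** A return with the smallest gap would run around a simple cycle; gaps 1 and 2 are excluded by
    [nbr_irr] and by the absence of backtracking, longer ones by acyclicity. *)
Lemma reduced_walk_inj (r : nat -> T) :
  walk r -> (forall n, r n.+2 <> r n) -> injective r.
Proof.
move=> wr red.
have main d : forall i, r i <> r (i + d.+1).
  elim/ltn_ind: d => d IH i rid.
  case: d IH rid => [|[|d]] IH rid.
  - by have := wr i; rewrite addn1 in rid; rewrite -rid (negbTE (nbr_irr _)).
  - by apply: (red i); rewrite rid addn2.
  pose p := mkseq (fun k => r (i + k)) d.+3.
  have sp : size p = d.+3 by rewrite size_mkseq.
  apply: (acyT (p := p)); first by rewrite sp.
  apply/andP; split; last first.
    rewrite map_inj_in_uniq ?iota_uniq // => a b.
    rewrite !mem_iota /= !add0n => ad bd rab.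
    have key x y : x < y -> y < d.+3 -> r (i + x) <> r (i + y).
      move=> xy yd e; have := IH (y - x).-1 _ (i + x).
      have -> : i + x + (y - x).-1.+1 = i + y by lia.
      by move=> H; apply: H e; lia.
    by have [ab|ab|//] := ltngtP a b; case: (key _ _ ab _) => //.
  apply: cycle_mkseq => [k _|]; first by rewrite /adj addnS; apply: wr.
  by rewrite /adj addn0 rid (addnS i d.+2); apply: wr.
move=> i j rij; have [ij|ji|//] := ltngtP i j.
- by case: (main (j - i).-1 i); rewrite rij; congr r; lia.
- by case: (main (i - j).-1 j); rewrite -rij; congr r; lia.
Qed.

Lemma reduced_walk_ray (r : nat -> T) :
  walk r -> (forall n, r n.+2 <> r n) -> ray r.
Proof. by move=> wr red; split=> //; apply: reduced_walk_inj. Qed.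

Lemma ray_reduced (r : nat -> T) n : ray r -> r n.+2 <> r n.
Proof. by move=> [inj _] /inj; lia. Qed.

Lemma ray_shift (r : nat -> T) k : ray r -> ray (fun n => r (n + k)).
Proof.
by move=> [inj wr]; split=> [i j /inj|n]; [lia | rewrite addSn; apply: wr].
Qed.

Lemma valence_le2 (v a b c : T) : valence v <= 2 ->
  a \in nbr v -> b \in nbr v -> c \in nbr v -> a <> b -> a <> c -> b = c.
Proof.
move=> vv av bv cv /eqP ab /eqP ac; apply/eqP; apply: contraTT vv => bc.
rewrite -ltnNge /valence.
have: uniq [:: a; b; c] by rewrite /= !inE negb_or ab ac bc.
move=> /uniq_leq_size; apply => x; rewrite !inE.
by case/or3P => /eqP ->.
Qed.

Lemma valence_gt2 (v a b : T) : 2 < valence v ->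
  exists2 c, c \in nbr v & c <> a /\ c <> b.
Proof.
move=> vv; apply: contrapT => H.
suff : valence v <= size [:: a; b] by move=> /=; lia.
apply: uniq_leq_size; first exact: fset_uniq.
move=> c cv; rewrite !inE; apply: contrapT => /negP; rewrite negb_or => /andP[/eqP ca /eqP cb].
by apply: H; exists c.
Qed.

Hypothesis val1 : forall v : T, valence v <> 1.

Lemma nbr_other (v a : T) : a \in nbr v -> exists2 c, c \in nbr v & c <> a.
Proof.
move=> av; apply: contrapT => H.
have : valence v <= size [:: a].
  apply: uniq_leq_size; first exact: fset_uniq.
  by move=> c cv; rewrite !inE; apply/eqP; apply: contrapT => ca; apply: H; exists c.
have : 0 < valence v by rewrite cardfs_gt0; apply/fset0Pn; exists a.
by have := @val1 v => /=; lia.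
Qed.

Lemma reduced_walk_from (a b : T) : b \in nbr a ->
  exists r : nat -> T, [/\ r 0 = a, r 1 = b, walk r & forall n, r n.+2 <> r n].
Proof.
move=> ab.
have /choice[nx nxP] (p : T * T) : exists c, p.1 \in nbr p.2 -> c \in nbr p.2 /\ c <> p.1.
  case: (boolP (p.1 \in nbr p.2)) => [/nbr_other[c ? ?]|_]; first by exists c.
  by exists p.1.
pose s n := iter n (fun p => (p.2, nx p)) (a, b).
have sw n : (s n).2 \in nbr (s n).1.
  elim: n => [//|n IH] /=; rewrite nbrC in IH; by have [] := nxP _ IH.
exists (fun n => (s n).1); split => //.
by move=> n /=; have := sw n; rewrite nbrC => /nxP[].
Qed.

(** At a branching vertex a ray can be left through a third neighbour and continued without
    backtracking, as no vertex has valence 1. Where valences are at most 2, two consecutive vertices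
    force the next one. *)
Lemma isolated_endP (r : nat -> T) : ray r ->
  (isolated_end r <-> exists n, forall m, n <= m -> valence (r m) <= 2).
Proof.
move=> rr; split=> [[n isor]|[n vn]].
  exists n.+1 => m nm; rewrite leqNgt; apply/negP => vm.
  have [c cm [c1 c2]] := valence_gt2 (r m.-1) (r m.+1) vm.
  have [s [s0 s1 ws sred]] := reduced_walk_from cm.
  pose q k := if k <= m then r k else s (k - m).
  have wq : walk q.
    move=> k; rewrite /q; have [km|km|->] := ltngtP k m.
    - exact: rr.2.
    - by rewrite subSn ?(ltnW km)//; apply: ws.
    - by rewrite subSnn s1.
  have redq k : q k.+2 <> q k.
    rewrite /q; have [km|km|km] := ltngtP k m.
    - case: ifP => km2; first exact: ray_reduced.
      have -> : k.+2 - m = 1 by lia.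
      rewrite s1; have -> : k = m.-1 by lia.
      exact: c1.
    - by rewrite ifF; [rewrite !subSn ?(ltnW km) ?leqW ?(ltnW km) // | lia].
    - rewrite km ifF; last by lia.
      have -> : m.+2 - m = 2 by lia.
      by rewrite -s0; apply: sred.
  have := isor q (reduced_walk_ray wq redq) _ m.+1.
  rewrite /q ifF ?subSnn; last by lia.
  rewrite s1; move=> H; apply: c2; apply: H => i im.
  by rewrite ifT //; lia.
exists n.+1 => r' rr' e.
have key : forall i, r' (n + i) = r (n + i) /\ r' (n + i).+1 = r (n + i).+1.
  elim=> [|i [e1 e2]]; first by rewrite addn0 !e.
  rewrite addnS; split=> //.
  apply: (@valence_le2 (r (n + i).+1) (r (n + i))).
  - by apply: vn; lia.
  - by rewrite nbrC; apply: rr.2.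
  - by rewrite -e2; apply: rr'.2.
  - exact: rr.2.
  - by rewrite -e1; apply/nesym/ray_reduced.
  - by apply/nesym/ray_reduced.
move=> i; have [ni|ni] := leqP n i.
  by rewrite -(subnKC ni) (key _).1.
by apply: e; lia.
Qed.

Lemma isolated_shift (r : nat -> T) k : ray r ->
  isolated_end r <-> isolated_end (fun n => r (n + k)).
Proof.
move=> rr; rewrite (isolated_endP rr) (isolated_endP (ray_shift k rr)); split=> -[n vn].
  by exists n => m nm; apply: vn; lia.
by exists (n + k) => m nm; rewrite -(subnK (n := m) (m := k)); [apply: vn|]; lia.
Qed.

Definition ray_cons (v : T) (r : nat -> T) n := if n is m.+1 then r m else v.

Lemma ray_consP v (r : nat -> T) : ray r -> r 0 \in nbr v -> r 1 <> v ->
  ray (ray_cons v r).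
Proof.
move=> rr rv r1; apply: reduced_walk_ray => [[|n] //=|[|n] //=].
  exact: rr.2.
exact: ray_reduced.
Qed.

Lemma isolated_cons v (r : nat -> T) : ray (ray_cons v r) -> isolated_end r ->
  isolated_end (ray_cons v r).
Proof.
move=> rr ir; apply/(isolated_shift 1 rr).
by have -> // : (fun n => ray_cons v r (n + 1)) = r by apply/funext => n; rewrite addn1.
Qed.

(** Were the first steps different, going back along [r] and then out along [r'] would be a walk
    without backtracking, hence injective, although it meets the common tail twice. *)
Lemma same_end_start (r r' : nat -> T) : ray r -> ray r' -> r 0 = r' 0 ->
  same_end r r' -> r 1 = r' 1.
Proof.
move=> rr rr' e0 [m [n e]]; apply: contrapT => ne.
(* Starting at [m.+1] and not at [m] keeps the two visits to the common vertex at different times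
   even if [m] and [n] are 0. *)
pose a := m.+1.
pose s k := if k <= a then r (a - k) else r' (k - a).
have ws : walk s.
  move=> k; rewrite /s; have [ka|ka|->] := ltngtP k a.
  - rewrite nbrC; have -> : a - k = (a - k.+1).+1 by lia.
    by apply: rr.2.
  - by rewrite subSn ?(ltnW ka)//; apply: rr'.2.
  - by rewrite subSnn subnn e0; apply: rr'.2.
have red k : s k.+2 <> s k.
  rewrite /s; have [ka|ka|->] := ltngtP k a.
  - case: ifP => ka2.
      have -> : a - k = (a - k.+2).+2 by lia.
      exact/nesym/ray_reduced.
    have -> : k.+2 - a = 1 by lia.
    have -> : a - k = 1 by lia.
    by apply/nesym.
  - rewrite ifF; last by lia.
    by rewrite !subSn ?(ltnW ka) ?leqW ?(ltnW ka) //; apply: ray_reduced.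
  - rewrite ifF; last by lia.
    have -> : a.+2 - a = 2 by lia.
    by rewrite subnn e0; apply: ray_reduced.
have := reduced_walk_inj ws red; move/(_ 0 (a + n.+1)).
rewrite /s /= ifF; last by lia.
rewrite subn0; have -> : a + n.+1 - a = n + 1 by lia.
by rewrite -e addn1 => /(_ erefl); lia.
Qed.

End Rays.

(** * The parent map *)

Section Parent.
Variables (R : realType) (T : ptree R).
Implicit Types (u v w : T) (r : nat -> T).

Let acyT := tree_acyclic (p := T).
Let val1 : forall v, valence v <> 1 := @valence_neq1 R T.

(** The given isolated ray is carried along a path to [v], dropping its first vertex or prepending a
    new one at each step. *)
Lemma isolated_ray_from v : exists r, [/\ ray r, isolated_end r & r 0 = v].
Proof.
have [z [rz iz]] := isolated_end_ex T.
have [_ /(_ (z 0) v)[p]] := tree_connected T.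
elim/last_ind: p v => [|p w IH] v.
  by move=> _ /= <-; exists z.
rewrite rcons_path last_rcons => /andP[pp adjw] <-.
have {IH pp}[r [rr ir r0]] := IH _ pp erefl.
have [e|ne] := pselect (r 1 = w).
  exists (fun n => r (n + 1)); split=> //; first exact: ray_shift.
  exact/(isolated_shift acyT val1 1 rr).
have rr' : ray (ray_cons w r).
  by apply: ray_consP => //; rewrite r0 nbrC.
by exists (ray_cons w r); split => //; apply: isolated_cons.
Qed.

Lemma above_ex v : exists w, above v w.
Proof. by have [r [rr ir r0]] := isolated_ray_from v; exists (r 1), r. Qed.

Lemma above_inj v w w' : above v w -> above v w' -> w = w'.
Proof.
move=> [r [rr ir r0 <-]] [r' [rr' ir' r0' <-]].
apply: same_end_start => //; first by rewrite r0.
exact: isolated_end_unique.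
Qed.

Definition parent v : T := xget v (above v).

Lemma parentP v : above v (parent v).
Proof. by have [w vw] := above_ex v; rewrite /parent; case: xgetP => // /(_ w). Qed.

Lemma above_parent v w : above v w -> w = parent v.
Proof. by move=> vw; apply: above_inj vw (parentP v). Qed.

Lemma isolated_ray_parent r : ray r -> isolated_end r ->
  forall n, r n = iter n parent (r 0).
Proof.
move=> rr ir; elim=> [//|n IH] /=; rewrite -IH; apply: above_parent.
exists (fun k => r (k + n)); split=> //; first exact: ray_shift.
exact/(isolated_shift acyT val1 n rr).
Qed.

Lemma parent_ray v : ray (fun n => iter n parent v) /\
  isolated_end (fun n => iter n parent v).
Proof.
have [r [rr ir r0]] := isolated_ray_from v.
have -> // : (fun n => iter n parent v) = r.
by apply/funext => n; rewrite (isolated_ray_parent rr ir) r0.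
Qed.

Lemma parent_nbr v : parent v \in nbr v.
Proof. by have [[_ w] _] := parent_ray v; apply: (w 0). Qed.

Lemma nbr_parent v : v \in nbr (parent v).
Proof. by rewrite nbrC parent_nbr. Qed.

Lemma iter_parent_inj v m n : iter m parent v = iter n parent v -> m = n.
Proof. by have [[inj _] _] := parent_ray v; apply: inj. Qed.

Lemma child_nbr v w : w \in nbr v -> w <> parent v -> parent w = v.
Proof.
move=> wv ne; have [rr ir] := parent_ray v.
have rr' : ray (ray_cons w (fun n => iter n parent v)).
  by apply: ray_consP => //=; [rewrite nbrC | apply/nesym].
apply/esym; apply: above_parent; exists (ray_cons w (fun n => iter n parent v)).
by split=> //; apply: isolated_cons.
Qed.

Lemma parent_parent v : parent (parent v) <> v.
Proof. by move=> e; have := @iter_parent_inj v 2 0 e. Qed.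

Lemma child_neq_parent v : v <> parent (parent v).
Proof. by move=> /esym; apply: parent_parent. Qed.

Lemma nbrP v w : w \in nbr v <-> w = parent v \/ parent w = v.
Proof.
split=> [wv|[->|<-]]; [|exact: parent_nbr|exact: nbr_parent].
by have [|/(child_nbr wv)] := pselect (w = parent v); [left | right].
Qed.

(** The indices ascend while the ray goes down, away from infinity. An isolated ray follows parents,
    which would make [r 1] its own grandparent. *)
Lemma ascending_not_isolated r : (forall n, parent (r n.+1) = r n) ->
  ray r /\ ~ isolated_end r.
Proof.
move=> pr.
have rr : ray r.
  apply: reduced_walk_ray => // [n|n e]; first by rewrite -(pr n) nbr_parent.
  by apply: (@parent_parent (r n)); rewrite -{1}e !pr.
split=> // ir; have := isolated_ray_parent rr ir 1.
by rewrite -(pr 0) /=; apply: child_neq_parent.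
Qed.

Lemma joined v w : exists m n, iter m parent v = iter n parent w.
Proof.
have [rv iv] := parent_ray v; have [rw iw] := parent_ray w.
by have [m [n /(_ 0)]] := isolated_end_unique rv iv rw iw; exists (m + 0), (n + 0).
Qed.

Lemma eventually_valence2 v : exists n, forall m, n <= m -> valence (iter m parent v) <= 2.
Proof. by have [rv iv] := parent_ray v; apply/isolated_endP. Qed.

Lemma branch_ex : exists v, 2 < valence v.
Proof.
have [z _] := isolated_end_ex T.
by have [w [m [n [vw _ _ _]]]] := grand_orbit_branches (z 0); exists w.
Qed.

Lemma top_ex : exists z, 2 < valence z /\
  forall k, 0 < k -> valence (iter k parent z) <= 2.
Proof.
have [w vw] := branch_ex.
have [n vn] := eventually_valence2 w.
have [k vk kmax] := @ex_maxnP (fun k => 2 < valence (iter k parent w)) n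
  (ex_intro _ 0 vw) (fun k => ltac:(by
    rewrite leqNgt; apply: contraTN => /ltnW /vn; rewrite -leqNgt)).
exists (iter k parent w); split=> // j j0; rewrite -iterD leqNgt.
by apply/negP => /kmax; lia.
Qed.

Definition top := projT1 (cid top_ex).

Lemma top_valence : 2 < valence top.
Proof. exact: (projT2 (cid top_ex)).1. Qed.

Lemma above_top_valence k : 0 < k -> valence (iter k parent top) <= 2.
Proof. exact: (projT2 (cid top_ex)).2. Qed.

(** A vertex strictly above [top] has no neighbours but its parent and one child, so the way back
    down involves no choice. *)
Lemma iter_parent_top_inj j k v :
  iter k parent v = iter k parent (iter j parent top) -> v = iter j parent top.
Proof.
elim: k v => [//|k IH] v /= e; apply: IH; set u := iter j _ _ in e *.
apply: (@valence_le2 T (parent (iter k parent v)) (parent (parent (iter k parent v)))).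
- by rewrite e /u -iterD; apply: (@above_top_valence (k + j).+1).
- exact: parent_nbr.
- exact: nbr_parent.
- by rewrite e nbr_parent.
- exact: parent_parent.
- by rewrite e; apply: parent_parent.
Qed.

(** Two common ancestors of [v] and [top] lie on one line of parents, which never repeats a vertex,
    so they give the same difference of step counts. *)
Lemma busemann_ex : {b : T -> int | forall v m n,
  iter m parent v = iter n parent top -> (b v = n%:Z - m%:Z)%R}.
Proof.
have /choice[f fP] v : exists mn : nat * nat, iter mn.1 parent v = iter mn.2 parent top.
  by have [m [n e]] := joined v top; exists (m, n).
apply: cid; exists (fun v => ((f v).2%:Z - (f v).1%:Z)%R) => v m n e.
have := fP v; move: (f v) => [m' n'] /= e'.
have : iter (m' + n) parent top = iter (m + n') parent top.
  by rewrite iterD -e -iterD addnC iterD e' -iterD.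
by move/iter_parent_inj; lia.
Qed.

Definition busemann : T -> int := projT1 busemann_ex.
Local Notation b := busemann.

Lemma busemannE v m n : iter m parent v = iter n parent top -> (b v = n%:Z - m%:Z)%R.
Proof. exact: (projT2 busemann_ex). Qed.

Lemma busemann_top : (b top = 0)%R.
Proof. exact: (@busemannE top 0 0). Qed.

Lemma busemann_parent v : (b (parent v) = b v + 1)%R.
Proof.
have [m [n e]] := joined v top.
rewrite (busemannE e) (@busemannE _ m n.+1); first by lia.
by rewrite -iterSr /= e.
Qed.

Lemma busemann_iter v k : (b (iter k parent v) = b v + k%:Z)%R.
Proof. by elim: k => [|k IH] /=; rewrite ?busemann_parent ?IH; lia. Qed.

(** The part of the tree at level at least 0 is the single line going up from [top]; vertices near
    infinity are named this way below. *)
Lemma busemann_ge0 v : (0 <= b v)%R -> v = iter `|b v| parent top.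
Proof.
have [m [n e]] := joined v top; rewrite (busemannE e) => nm.
have {}nm : m <= n by lia.
have -> : `|(n%:Z - m%:Z)%R|%N = n - m by lia.
by apply: (@iter_parent_top_inj _ m); rewrite -iterD subnKC.
Qed.

End Parent.

Arguments parent {R T} v.
Arguments busemann {R T} _.

(** * The geometric realization *)

Local Open Scope ring_scope.

Section Geo.
Variables (T : graph) (R : realType).
Implicit Types (x y : geo T R) (u v w : T).

Lemma geo_ext x y : Defs.coord x = Defs.coord y -> x = y.
Proof.
case: x y => [f fP] [g gP] /= fg; case: _ / fg in gP *.
congr Geo; exact: Prop_irrelevance.
Qed.

Lemma geo_ex u w (t : R) : simplex u w -> 0 <= t <= 1 ->
  exists x, Defs.coord x = bary u w t.
Proof.
move=> uw t01.
by exists (Geo (ex_intro _ u (ex_intro _ w (ex_intro _ t (And3 uw t01 erefl))))).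
Qed.

Lemma geo_openE (U : set (geo T R)) : open U = geo_open U.
Proof. by []. Qed.

Lemma open_star v : open (star v : set (geo T R)).
Proof.
rewrite geo_openE => u w t x [uw t01 xE]; rewrite /star /= xE => v0.
exists (bary u w t v) => // t' y [_ _ yE] tt'; rewrite yE.
have : bary u w t' v = bary u w t v + (t' - t) * ((v == w)%:R - (v == u)%:R).
  by rewrite /bary; ring.
move=> ->.
suff: `|(t' - t) * ((v == w)%:R - (v == u)%:R)| < bary u w t v.
  by rewrite ltr_norml => /andP[]; lra.
rewrite normrM; apply: le_lt_trans tt'; rewrite ler_piMr //.
by case: (v == w); case: (v == u); rewrite ?subrr ?sub0r ?subr0 ?normrN ?normr1 ?normr0.
Qed.

Lemma bary_swap u w (t : R) : bary u w t = bary w u (1 - t).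
Proof. by apply/funext => v; rewrite /bary; ring. Qed.

Lemma bary0 u w : bary u w 0 = fun v => (v == u)%:R :> R.
Proof. by apply/funext => v; rewrite /bary; ring. Qed.

Lemma bary_start u w (t : R) : w <> u -> bary u w t u = 1 - t.
Proof. by move=> /eqP wu; rewrite /bary eqxx eq_sym (negbTE wu) mulr0 addr0 mulr1. Qed.

Lemma bary_end u w (t : R) : w <> u -> bary u w t w = t.
Proof. by move=> /eqP wu; rewrite /bary eqxx (negbTE wu) mulr0 add0r mulr1. Qed.

Lemma bary_neq u w v (t : R) : v <> u -> v <> w -> bary u w t v = 0.
Proof. by move=> /eqP vu /eqP vw; rewrite /bary (negbTE vu) (negbTE vw) !mulr0 addr0. Qed.

Lemma bary_same u (t : R) : bary u u t = bary u u 0.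
Proof. by apply/funext => v; rewrite /bary; ring. Qed.

Lemma bary_inj u w w' (t t' : R) : w <> u -> w' <> u ->
  bary u w t = bary u w' t' -> t = t' /\ (t != 0 -> w = w').
Proof.
move=> wu w'u e; have := congr1 (fun f => f u) e.
rewrite !bary_start // => tt'; split; first by lra.
move=> t0; apply: contrapT => ww'; have := congr1 (fun f => f w) e.
by rewrite bary_end // bary_neq // => t00; rewrite t00 eqxx in t0.
Qed.

(** The coordinates are 2/3 at the start and 1/3 at the end, so one point determines the oriented
    edge; a midpoint would not tell the ends apart. *)
Lemma bary3_inj u w u' w' : w <> u -> w' <> u' ->
  bary u w (3^-1 : R) = bary u' w' 3^-1 -> u = u' /\ w = w'.
Proof.
move=> wu w'u' e; have uu' : u = u'.
  apply: contrapT => uu'; have := congr1 (fun f => f u) e.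
  rewrite bary_start // /bary; move/eqP: uu' => /negbTE ->.
  by case: (u == w') => /=; lra.
split=> //; move: e; rewrite -uu' in w'u' * => /(bary_inj wu w'u')[_]; apply.
by rewrite invr_eq0 pnatr_eq0.
Qed.

Lemma starP v x : (exists w, w \in nbr v) -> star v x ->
  exists w t, [/\ w \in nbr v, 0 <= t < 1 & Defs.coord x = bary v w t].
Proof.
move=> [a av]; have [u [w [t [uw t01 xE]]]] := coordP x.
have aE : bary v v t = bary v a 0 by rewrite !bary0 bary_same bary0.
rewrite /star /= xE; have [vu|/eqP vu] := eqVneq v u.
  rewrite -vu in uw xE *; case: uw => [wE|uw] vx.
    by exists a, 0; rewrite av lexx ltr01 wE aE.
  exists w, t; split=> //; rewrite bary_start in vx; last exact: nbr_neq.
  by lra.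
have [vw|/eqP vw] := eqVneq v w; last by rewrite bary_neq // ltxx.
rewrite -vw in uw xE * => vx; case: uw => // uv.
rewrite bary_end // in vx.
by exists u, (1 - t); rewrite nbrC uv [in LHS]bary_swap; split=> //; lra.
Qed.

Lemma star_bary v w (t : R) x : w <> v -> Defs.coord x = bary v w t -> star v x <-> t < 1.
Proof. by move=> wv xE; rewrite /star /= xE bary_start // subr_gt0. Qed.

Lemma star_bary_end v w (t : R) x : w <> v -> Defs.coord x = bary v w t -> star w x <-> 0 < t.
Proof. by move=> wv xE; rewrite /star /= xE bary_end. Qed.

Lemma cover_star x : exists v, star v x.
Proof.
have [u [w [t [uw t01 xE]]]] := coordP x.
have [/eqP t1|t1] := boolP (t == 1); last first.
  exists u; rewrite /star /= xE /bary eqxx mulr1.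
  have : 0 <= t * (u == w)%:R by rewrite mulr_ge0 //; lra.
  have : t < 1 by rewrite lt_neqAle t1; lra.
  by lra.
by exists w; rewrite /star /= xE t1 /bary eqxx subrr mul0r add0r mulr1.
Qed.

End Geo.

Section GeoMapE.
Variables (R : realType) (T T' : graph) (F : T -> T') (sF : simplicial F).

Lemma coord_geo_map (x : geo T R) u w (t : R) : Defs.coord x = bary u w t ->
  Defs.coord (geo_map sF x) = bary (F u) (F w) t.
Proof. exact: push_bary. Qed.

Lemma geo_map_open_nbr (v : T) (w' : T') (U : set (geo T R)) x :
  open (geo_map sF @` U) -> U x -> w' \in nbr (F v) ->
  Defs.coord (geo_map sF x) = bary (F v) (F v) 0 ->
  exists2 y, U y & exists2 t : R, 0 < t < 1 & Defs.coord (geo_map sF y) = bary (F v) w' t.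
Proof.
rewrite geo_openE => oFU Ux w'v xE.
have /oFU/(_ (imageP _ Ux))[e e0] : on_simplex (F v) w' 0 (geo_map sF x).
  by split; [right|lra|rewrite xE !bary0].
(* Half of [e] makes [t] strictly smaller than [e]; 1/2 keeps the point inside the edge. *)
pose t := Num.min (e / 2) (2^-1).
have e2 : 0 < e / 2 by apply: divr_gt0.
have t01 : 0 < t < 1 by rewrite /t lt_min e2 gt_min invr_gt0 ltr0n /=; lra.
have te : t < e by rewrite /t gt_min; apply/orP; left; lra.
have [z zE] : exists z : geo T' R, Defs.coord z = bary (F v) w' t.
  by apply: geo_ex; [right|lra].
move=> /(_ t z); case.
- by split=> //; [right|lra].
- by rewrite subr0 gtr0_norm //; lra.
by move=> y Uy yz; exists y => //; exists t; rewrite ?yz.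
Qed.

End GeoMapE.

(** * The tree map on stars and on fibres *)

Section PTreeMap.
Variables (R : realType) (T : ptree R).
Implicit Types (u v w : T).
Local Notation F := (@tmap R T).
Local Notation sF := (@tmap_simplicial R T).

Lemma vertex_pt v : exists x : geo T R, Defs.coord x = bary v v 0.
Proof. by apply: geo_ex; [left|rewrite lexx ler01]. Qed.

Lemma has_nbr v : exists w, w \in nbr v.
Proof. by exists (parent v); apply: parent_nbr. Qed.

(** A collapsed edge would have an open interior [U] with a single point as image, while an open
    image must enter some edge at that point. *)
Lemma tmap_nbr v w : w \in nbr v -> F w \in nbr (F v).
Proof.
move=> wv; have [Fwv|//] := tmap_simplicial (or_intror wv : simplex v w).
have wNv := nbr_neq wv.
pose U : set (geo T R) := star v `&` star w.
have oU : open U by apply: openI; apply: open_star.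
have UE x : U x -> Defs.coord (geo_map sF x) = bary (F v) (F v) 0.
  move=> [xv xw]; have [u [t [uv t01 xE]]] := starP (has_nbr v) xv.
  have uw : w = u.
    apply: contrapT => wu; move: xw.
    by rewrite /star /= xE bary_neq // ltxx.
  by rewrite -uw in xE; rewrite (coord_geo_map _ xE) Fwv bary_same.
have [x xE] : exists x : geo T R, Defs.coord x = bary v w 2^-1.
  by apply: geo_ex; [right | lra].
have Ux : U x by split; [apply/(star_bary wNv xE)|apply/(star_bary_end wNv xE)]; lra.
have [y Uy [t t01]] := geo_map_open_nbr (tmap_open oU) Ux (parent_nbr (F v)) (UE _ Ux).
rewrite UE // => /(congr1 (fun f => f (F v))).
rewrite [X in _ = X]bary_start; last exact: (nbr_neq (parent_nbr _)).
rewrite bary0 eqxx /= => t0.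
suff: (0 : R) < 0 by rewrite ltxx.
by lra.
Qed.

Lemma tmap_nbr_surj v w' : w' \in nbr (F v) -> exists2 w, w \in nbr v & F w = w'.
Proof.
move=> w'v; have [x xE] := vertex_pt v.
have xv : star v x by rewrite /star /= xE bary0 eqxx.
have [|y yv [t t01]] := geo_map_open_nbr (tmap_open (@open_star _ _ v)) xv w'v.
  by rewrite (coord_geo_map _ xE).
have [w [s [wv s01 yE]]] := starP (has_nbr v) yv.
rewrite (coord_geo_map _ yE) => /(@bary_inj _ _ (F v)) [].
- exact: (nbr_neq (tmap_nbr wv)).
- exact: (nbr_neq w'v).
move=> st Fw; exists w => //; apply: Fw; rewrite st; apply/eqP; lra.
Qed.

(** By properness the preimage of a vertex point is compact, while distinct vertices cannot
    accumulate: every point has a neighbourhood [star v], whose only vertex is [v]. *)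
Lemma fiber_no_inj_seq (a : nat -> T) u : (forall n, F (a n) = u) -> ~ injective a.
Proof.
move=> aF inja.
have /choice[p pE] n : exists x : geo T R, Defs.coord x = bary (a n) (a n) 0 by exact: vertex_pt.
have [q qE] := vertex_pt u.
have := tmap_proper (@compact_set1 _ q) (F := p @ \oo).
case.
  exists 0%N => // n _ /=; apply: geo_ext.
  by rewrite (coord_geo_map _ (pE n)) aF qE.
move=> x [_ clx]; have [v xv] := cover_star x.
have nx : nbhs x (star v) by apply: open_nbhs_nbhs; split=> //; apply: open_star.
have [N aN] : exists N, forall n, (N <= n)%N -> a n <> v.
  have [[k ak]|nv] := pselect (exists k, a k = v).
    by exists k.+1 => n kn; rewrite -ak => /inja nk; rewrite nk ltnn in kn.
  by exists 0%N => n _ e; apply: nv; exists n.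
have [|y []] := clx (p @` [set n | (N <= n)%N]) _ _ nx.
  by exists N => // n Nn; exists n.
move=> [n Nn <-]; rewrite /star /= pE bary0.
by have /eqP/negbTE := aN _ Nn; rewrite eq_sym => ->; rewrite ltxx.
Qed.

End PTreeMap.

(** * Local degrees and the spine *)

Local Open Scope nat_scope.

Lemma nonincreasing_eventually (f : nat -> nat) n0 : (forall n, n0 <= n -> f n.+1 <= f n) ->
  exists n1, n0 <= n1 /\ forall n, n1 <= n -> f n.+1 = f n.
Proof.
have [m] := ubnP (f n0); elim: m n0 => [//|m IH] n0 fm mono.
have [[n [n0n fn]]|H] := pselect (exists n, n0 <= n /\ f n.+1 < f n).
  have fn0 j : f (n0 + j) <= f n0.
    elim: j => [|j]; first by rewrite addn0.
    by apply: leq_trans; rewrite addnS mono // leq_addr.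
  have := fn0 (n - n0); rewrite subnKC // => fn'.
  have [||n1 [n1n H]] := IH n.+1; first by lia.
    by move=> k nk; apply: mono; lia.
  by exists n1; split=> //; lia.
exists n0; split=> // n n0n; apply/eqP; rewrite eqn_leq mono //= leqNgt.
by apply/negP => fn; apply: H; exists n.
Qed.

Section Degrees.
Variables (R : realType) (T : ptree R).
Implicit Types (u v w : T).
Local Notation F := (@tmap R T).

Lemma vdeg_split v w' : w' \in nbr v ->
  vdeg v = edeg v w' + \sum_(w <- nbr v | (F w == F w') && (w != w')) edeg v w.
Proof.
move=> wv; rewrite (vdegE wv) (big_rem w') //= eqxx rem_filter ?fset_uniq //.
by rewrite big_filter_cond /=; under eq_bigl do rewrite andbC.
Qed.

Lemma edeg_le_vdeg v w : w \in nbr v -> edeg v w <= vdeg v.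
Proof. by move=> wv; rewrite (vdeg_split wv) leq_addr. Qed.

Lemma edegD_le_vdeg v w w' : w \in nbr v -> w' \in nbr v -> F w = F w' -> w <> w' ->
  edeg v w + edeg v w' <= vdeg v.
Proof.
move=> wv w'v Fw /eqP ww'; rewrite addnC (vdeg_split w'v) leq_add2l.
by rewrite (big_rem w) //= Fw eqxx ww' leq_addr.
Qed.

Lemma vdeg_edeg v w' : w' \in nbr v -> (forall w, w \in nbr v -> F w = F w' -> w = w') ->
  vdeg v = edeg v w'.
Proof.
move=> wv H; rewrite (vdeg_split wv) big1_seq ?addn0 // => w /andP[/andP[/eqP Fw /eqP ww']].
by move=> /H /(_ Fw).
Qed.

Section Folding.
Variables (r : nat -> T) (y : T).
Hypothesis parent_r : forall n, parent (r n.+1) = r n.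
Hypothesis F_r : forall n, F (r n) = iter n parent y.
Variable K : nat.
Hypothesis valK : forall m, K <= m -> valence (iter m parent y) <= 2.

Let nbr_r n : r n \in nbr (r n.+1).
Proof. by rewrite -(parent_r n) parent_nbr. Qed.

Let nbr_rS n : r n.+1 \in nbr (r n).
Proof. by rewrite nbrC. Qed.

(** The line of images can be lifted downwards from [c] because neighbours lift; the lift cannot
    turn up to [parent c], whose image lies on the other side. It stops over the fixed vertex
    [iter K parent y]. *)
Lemma descend j c : F c = iter (j + K) parent y -> F (parent c) = iter (j + K).+1 parent y ->
  exists2 e, F e = iter K parent y & iter j parent e = c.
Proof.
elim: j c => [|j IH] c Fc Fpc; first by exists c.
have [|c' c'c Fc'] := @tmap_nbr_surj R T c (iter (j + K) parent y).
  by rewrite Fc /= nbr_parent.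
have pc' : parent c' = c.
  apply: (child_nbr c'c) => e; move: Fc'; rewrite e Fpc => /iter_parent_inj; lia.
have [||e Fe je] := IH c'; rewrite ?pc' //.
by exists e => //=; rewrite je.
Qed.

Lemma busemann_r n : (busemann (r n) = busemann (r 0) - n%:Z)%R.
Proof.
by elim: n => [|n IH]; [|have := busemann_parent (r n.+1); rewrite parent_r IH]; lia.
Qed.

(** Each merge at [r k.+1] starts a second lift, which [descend] continues to the fibre over
    [iter K parent y]. Different [k] reach different levels, so infinitely many merges would
    contradict properness. *)
Lemma no_merging : exists K1, K <= K1 /\
  forall k, K1 <= k -> forall a, a \in nbr (r k.+1) -> F a = F (r k) -> a = r k.
Proof.
apply: contrapT => H.
(* The merging child [a] of [r k.+1] is [k + 2] levels below [r 0], and [e] is [k - K] levels below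
   [a]. *)
have bad k0 : exists k, k0 <= k /\ exists e, F e = iter K parent y /\
    (busemann e = busemann (r 0) - 2 * k%:Z - 1 + K%:Z - 1)%R.
  apply: contrapT => nb; apply: H; exists (maxn k0 K); split; first by rewrite leq_maxr.
  move=> k k0k a ark Fa; apply: contrapT => ar; apply: nb; exists k; split; first by lia.
  have pa : parent a = r k.+1 by apply: child_nbr => //; rewrite parent_r.
  have kK : k = (k - K) + K by lia.
  have [||e Fe je] := @descend (k - K) a.
  - by rewrite Fa F_r -kK.
  - by rewrite pa F_r -kK.
  exists e; split=> //.
  have := busemann_iter e (k - K); have := busemann_parent a; rewrite je pa busemann_r.
  lia.
have /choice[kk kkP] := bad.
pose ks n := iter n (fun k => kk k.+1) (kk 0).
have ksP n : exists e, F e = iter K parent y /\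
    (busemann e = busemann (r 0) - 2 * (ks n)%:Z - 1 + K%:Z - 1)%R.
  by case: n => [|n] /=; [exact: (kkP 0).2|exact: (kkP _).2].
have ksS n : ks n < ks n.+1 by exact: (kkP _).1.
have ks_lt m n : m < n -> ks m < ks n.
  elim: n => [//|n IH]; rewrite ltnS leq_eqVlt => /orP[/eqP ->|/IH]; first exact: ksS.
  by move=> /ltn_trans; apply.
have /choice[e eP] := ksP.
apply: (@fiber_no_inj_seq R T e (iter K parent y)) => [n|]; first exact: (eP n).1.
move=> m n emn; have [mn|mn|//] := ltngtP m n.
- by have := ks_lt _ _ mn; have := (eP m).2; rewrite emn (eP n).2; lia.
- by have := ks_lt _ _ mn; have := (eP m).2; rewrite emn (eP n).2; lia.
Qed.

(* Past [K1] nothing merges, so the degree of the edges along [r] drops at each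
   branching; hence [r] branches finitely often. *)
Lemma folding_ray_isolated : isolated_end r.
Proof.
have [K1 [KK1 nm]] := no_merging.
pose D n := edeg (r n) (r n.+1).
have vdegD k : K1 <= k -> vdeg (r k.+1) = D k.
  move=> k1; rewrite (@vdeg_edeg _ (r k)) ?nbr_r //; last exact: nm.
  by rewrite /D edeg_sym.
have Dmono k : K1 <= k -> D k.+1 <= D k.
  by move=> k1; rewrite -(vdegD k) //; apply: edeg_le_vdeg (nbr_rS _).
have [K2 [K12 Dcst]] := nonincreasing_eventually Dmono.
have [rr _] := ascending_not_isolated parent_r.
apply/isolated_endP => //; [exact: tree_acyclic|exact: valence_neq1|].
exists K2.+1 => -[//|k] k2; rewrite leqNgt; apply/negP => vk.
have [a ak [ak1 ak2]] := valence_gt2 (r k) (r k.+2) vk.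
(* The image of [r k.+1] has valence at most 2 and [F a] is not its lower neighbour, so [a] and
   [r k.+2] are folded together. Both edges then count in the degree of [r k.+1], which equals
   [D k], hence [D k.+1]: too small for both. *)
have Fa : F a = F (r k.+2).
  have Fa0 : F a <> F (r k) by move=> Fa; apply: ak1; apply: nm Fa => //; lia.
  apply: (@valence_le2 T (iter k.+1 parent y) (iter k parent y)).
  - by apply: valK; lia.
  - exact: nbr_parent.
  - by rewrite -F_r; apply: tmap_nbr.
  - by rewrite F_r /= parent_nbr.
  - by rewrite -F_r => /esym.
  - by rewrite F_r => /iter_parent_inj; lia.
have := edegD_le_vdeg ak (nbr_rS k.+1) Fa ak2.
rewrite vdegD; last by lia.
have := edeg_gt0 ak; have := Dcst k; rewrite /D => -> //; lia.
Qed.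

End Folding.

(** Otherwise a lift from [v] of the line of parents of [F v] starts with a child. It can never turn
    back up, since images two steps apart differ, so it is a descending ray that folding makes
    isolated. *)
Lemma tmap_parent v : F (parent v) = parent (F v).
Proof.
apply: contrapT => nF.
have /choice[nx nxP] u : exists c, c \in nbr u /\ F c = parent (F u).
  by have [c] := tmap_nbr_surj (parent_nbr (F u)); exists c.
pose r n := iter n nx v.
have F_r n : F (r n) = iter n parent (F v).
  by elim: n => [//|n IH] /=; rewrite (nxP _).2 IH.
have parent_r n : parent (r n.+1) = r n.
  elim: n => [|n IH]; apply: (child_nbr (nxP _).1) => e.
    by apply: nF; rewrite -e (nxP _).2.
  have := (nxP (r n.+1)).2; rewrite e IH F_r (F_r n.+1) => /(@iter_parent_inj _ _ _ n n.+2).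
  lia.
have [K valK] := eventually_valence2 (F v).
have [_] := ascending_not_isolated parent_r.
by apply; apply: folding_ray_isolated valK.
Qed.

Lemma tmap_iter_parent n v : F (iter n parent v) = iter n parent (F v).
Proof. by elim: n => [//|n IH]; rewrite /= tmap_parent IH. Qed.

Definition tmap_shift : int := busemann (F (top T)).

Lemma busemann_tmap v : (busemann (F v) = busemann v + tmap_shift)%R.
Proof.
have [m [n e]] := joined v (top T).
have := busemann_iter (F v) m; have := busemann_iter (F (top T)) n.
rewrite -!tmap_iter_parent e /tmap_shift (busemannE e); lia.
Qed.

(** The other edges at [v] go down and so do their images, so the edge above [v] is alone over its
    image. *)
Lemma vdeg_parent v : vdeg v = edeg v (parent v).
Proof.
apply: vdeg_edeg (parent_nbr v) _ => w wv Fw.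
apply: contrapT => /(child_nbr wv) pw.
have := congr1 (@busemann R T) Fw; rewrite !busemann_tmap -pw !busemann_parent; lia.
Qed.

End Degrees.

Section Spine.
Variables (R : realType) (T : mptree R).
Implicit Types (u v w : T).
Local Notation F := (@tmap R T).
Local Notation N := (@tmap_shift R T).
Local Notation b := (@busemann R T).

(** Shift 0 would fix the edge above [top], against the expansion of lengths. A negative shift would
    send a vertex strictly above [top], of valence at most 2, to [top], and three neighbours of
    [top] would need distinct lifts. *)
Lemma tmap_shift_gt0 : (0 < N)%R.
Proof.
have b0 v : b v = 0%R -> v = top T by move=> bv; rewrite (@busemann_ge0 _ _ v) bv.
have N0 : N <> 0%R.
  move=> N0; have Ft : F (top T) = top T by apply: b0.
  have := len_tmap (parent_nbr (top T)).
  rewrite tmap_parent Ft => e.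
  have := len_gt0 (parent_nbr (top T)); have := degree_gt1 T.
  rewrite -(ltr_nat R) => d1 l0.
  have : (1 * len (top T) (parent (top T)) < (degree T)%:R * len (top T) (parent (top T)))%R.
    by rewrite ltr_pM2r.
  by rewrite -e mul1r ltxx.
have [//|Nneg|/esym/N0//] := ltgtP 0%R N.
have Fz : F (iter `|N| parent (top T)) = top T.
  by apply: b0; rewrite busemann_tmap busemann_iter busemann_top; lia.
have [w1 w1n _] := valence_gt2 (top T) (top T) (top_valence T).
have [w2 w2n [w21 _]] := valence_gt2 w1 w1 (top_valence T).
have [w3 w3n [w31 w32]] := valence_gt2 w1 w2 (top_valence T).
move: w1n w2n w3n; rewrite -Fz => /tmap_nbr_surj[a an aE] /tmap_nbr_surj[c cn cE].
move=> /tmap_nbr_surj[e en eE]; case: w32; rewrite -cE -eE; congr F.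
apply: (valence_le2 _ an en cn).
- by apply: above_top_valence; lia.
- by move=> ae; apply: w31; rewrite -aE -eE ae.
- by move=> ac; apply: w21; rewrite -aE -cE ac.
Qed.

Lemma in_spineP v : in_spine v <-> 1 < vdeg v.
Proof.
split=> [[w wv]|vv]; first by move=> /leq_trans; apply; apply: edeg_le_vdeg.
by exists (parent v); [exact: parent_nbr|rewrite -vdeg_parent].
Qed.

Lemma in_spine_parent v : in_spine v -> in_spine (parent v).
Proof.
move=> /in_spineP; rewrite vdeg_parent edeg_sym ?parent_nbr // => vv.
by exists v => //; apply: nbr_parent.
Qed.

Lemma in_spine_iter n v : in_spine v -> in_spine (iter n parent v).
Proof. by move=> vs; elim: n => [//|n]; apply: in_spine_parent. Qed.

(** A vertex of maximal degree lies in the spine, hence so do its ancestors, which end up on the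
    single line above [top]. *)
Lemma eventually_in_spine : exists2 K : int, (0 <= K)%R & forall v, (K <= b v)%R -> in_spine v.
Proof.
have [u ud] := degree_attained T.
have us : in_spine u by apply/in_spineP; rewrite ud degree_gt1.
have [m [n e]] := joined u (top T).
exists (n%:Z)%R => // v nv.
have -> : v = iter (`|b v| - n) parent (iter m parent u).
  rewrite e -iterD subnK; last by lia.
  by apply: busemann_ge0; lia.
by do 2!apply: in_spine_iter.
Qed.

Lemma tmap_nbr_inj v w w' : ~ in_spine v -> w \in nbr v -> w' \in nbr v ->
  F w = F w' -> w = w'.
Proof.
move=> vs wv w'v Fw; apply: contrapT => ww'; apply: vs; apply/in_spineP.
have := edegD_le_vdeg wv w'v Fw ww'; have := edeg_gt0 wv; have := edeg_gt0 w'v.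
lia.
Qed.

End Spine.

(** * Extending a spine isomorphism to the tree *)

Section ReturnTime.
Variables (R : realType) (T : mptree R).
Implicit Types (u v w : T).
Local Notation F := (@tmap R T).
Local Notation b := (@busemann R T).

Lemma busemann_iter_tmap n v : (b v + n%:Z <= b (iter n F v))%R.
Proof.
by elim: n => [|n IH] /=; rewrite ?busemann_tmap; [|have := tmap_shift_gt0 T]; lia.
Qed.

(** Orbits climb at least one level per step and all high vertices are in the spine. Hence the
    default of [xget] in [return_time] is never taken. *)
Lemma iter_tmap_in_spine v : exists2 n, 0 < n & in_spine (iter n F v).
Proof.
have [K K0 KS] := eventually_in_spine T.
exists (`|b v| + `|K|).+1 => //; apply: KS.
have := busemann_iter_tmap (`|b v| + `|K|).+1 v; lia.
Qed.

Lemma least_spine_time v : exists s, [/\ 0 < s, in_spine (iter s F v) &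
  forall i, 0 < i < s -> ~ in_spine (iter i F v)].
Proof.
have [n n0 nS] := iter_tmap_in_spine v.
have ex : exists s, (0 < s) && `[< in_spine (iter s F v) >] by exists n; rewrite n0; apply/asboolP.
case: (ex_minnP ex) => s /andP[s0 /asboolP sS] smin.
exists s; split=> // i /andP[i0 si] iS.
by have := smin i; rewrite i0 (asboolT iS) leqNgt si => /(_ erefl).
Qed.

Lemma return_timeP v : [/\ 0 < return_time v, in_spine (iter (return_time v) F v) &
  forall i, 0 < i < return_time v -> ~ in_spine (iter i F v)].
Proof.
have [s sP] := least_spine_time v.
by rewrite /return_time; case: xgetP => [s' _ //|/(_ s)].
Qed.

Lemma return_timeE v s : 0 < s -> in_spine (iter s F v) ->
  (forall i, 0 < i < s -> ~ in_spine (iter i F v)) -> return_time v = s.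
Proof.
move=> s0 sS smin; have [r0 rS rmin] := return_timeP v.
have [rs|sr|//] := ltngtP (return_time v) s.
  by case: (smin (return_time v)); rewrite ?r0.
by case: (rmin s); rewrite ?s0.
Qed.

Lemma iter_tmap_parent n v : iter n F (parent v) = parent (iter n F v).
Proof. by elim: n => [//|n IH]; rewrite /= IH tmap_parent. Qed.

Lemma iter_tmap_nbr n v w : w \in nbr v -> iter n F w \in nbr (iter n F v).
Proof. by move=> wv; elim: n => [//|n]; apply: tmap_nbr. Qed.

Lemma iter_tmap_nbr_inj n v w w' : (forall i, i < n -> ~ in_spine (iter i F v)) ->
  w \in nbr v -> w' \in nbr v -> iter n F w = iter n F w' -> w = w'.
Proof.
elim: n => [//|n IH] vS wv w'v /= e; apply: IH => // [i ni|]; first by apply: vS; lia.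
by apply: tmap_nbr_inj e; [apply: vS|apply: iter_tmap_nbr|apply: iter_tmap_nbr].
Qed.

End ReturnTime.

Section Extension.
Variable R : realType.

(* Stated for a relation so that the two trees play symmetric roles. *)
Record spine_rel (T1 T2 : mptree R) (P : T1 -> T2 -> Prop) := SpineRel {
  spine_rel_dom : forall v v', P v v' -> in_spine (parent v);
  spine_rel_codom : forall v v', P v v' -> in_spine (parent v');
  spine_rel_total : forall v, in_spine (parent v) -> exists v', P v v';
  spine_rel_surj : forall v', in_spine (parent v') -> exists v, P v v';
  spine_rel_fun : forall v v1 v2, P v v1 -> P v v2 -> v1 = v2;
  spine_rel_inj : forall v' v1 v2, P v1 v' -> P v2 v' -> v1 = v2;
  spine_rel_spine : forall v v', P v v' -> (in_spine v <-> in_spine v');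
  spine_rel_parent : forall v v', P v v' -> P (parent v) (parent v');
  spine_rel_return : forall w w', in_spine w -> P w w' -> 
    P (iter (return_time w) (@tmap R T1) w) (iter (return_time w') (@tmap R T2) w');
  spine_rel_return_child : forall v v', P v v' ->
    P (iter (return_time (parent v)) (@tmap R T1) v)
      (iter (return_time (parent v')) (@tmap R T2) v') }.

Lemma spine_rel_sym (T1 T2 : mptree R) (P : T1 -> T2 -> Prop) :
  spine_rel P -> spine_rel (fun v' v => P v v').
Proof.
move=> [dm cd tot sur fn inj sp par ret retc].
split=> //=; last by move=> v v' ?; apply: retc.
- by move=> v' v; apply: cd.
- by move=> v' v; apply: dm.
- by move=> v' v /sp [].
- by move=> v' v; apply: par.
- by move=> w' w wS Pw; apply: ret => //; apply/(sp _ _ Pw).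
Qed.

(** The constructors exclude each other when [P] only concerns vertices with parent in the spine;
    uniqueness of partners rests on this. *)
Inductive ext_rel (T1 T2 : mptree R) (P : T1 -> T2 -> Prop) : T1 -> T2 -> Prop :=
| ext_base v v' : P v v' -> ext_rel P v v'
| ext_step v v' : ~ in_spine (parent v) -> ~ in_spine (parent v') ->
    ext_rel P (parent v) (parent v') -> ext_rel P (tmap v) (tmap v') -> ext_rel P v v'.

Lemma ext_rel_sym (T1 T2 : mptree R) (P : T1 -> T2 -> Prop) v v' :
  ext_rel P v v' -> ext_rel (fun v' v => P v v') v' v.
Proof. by elim=> [{}v {}v' ?|*]; [apply: ext_base | apply: ext_step]. Qed.

Section Totality.
Variables (T1 T2 : mptree R) (P : T1 -> T2 -> Prop) (hP : spine_rel P).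
Local Notation Q := (ext_rel P).

(** The invariant of the descending induction: the three compatibilities at higher vertices are what
    the step at a lower one consumes. *)
Definition determined v := exists v', [/\ Q v v', forall v'', Q v v'' -> v'' = v',
  in_spine v <-> in_spine v', Q (parent v) (parent v') & Q (tmap v) (tmap v')].

Lemma determined_rel v v' : determined v -> Q v v' -> [/\ in_spine v <-> in_spine v',
  Q (parent v) (parent v') & Q (tmap v) (tmap v')].
Proof. by move=> [v0 [_ uniq0 ? ? ?]] /uniq0 ->; split. Qed.

Lemma determined_uniq v v1 v2 : determined v -> Q v v1 -> Q v v2 -> v1 = v2.
Proof. by move=> [v0 [_ uniq0 _ _ _]] /uniq0 -> /uniq0 ->. Qed.

(** For the base of the induction: at this height the first image is already in the spine on both
    sides, so return times are 1 and [spine_rel_return] is plain compatibility with the maps. *)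
Lemma spine_near_infinity : exists K : int, forall v, (K <= busemann v)%R ->
  [/\ in_spine v, in_spine (tmap v) & forall v', P v v' -> in_spine (tmap v')].
Proof.
have [K1 K10 S1] := eventually_in_spine T1; have [K2 K20 S2] := eventually_in_spine T2.
pose u := iter `|K1| parent (top T1).
have bu : busemann u = K1 by rewrite busemann_iter busemann_top; lia.
have [|u' Pu] := spine_rel_total hP (v := u).
  by apply: S1; rewrite busemann_parent bu; lia.
have Pk k : P (iter k parent u) (iter k parent u').
  by elim: k => [//|k IH]; apply: (spine_rel_parent hP).
(* After that many parents beyond [u], the partner is at level [K2] or more, whatever the sign of
   [busemann u']. *)
exists (K1 + (`|K2| + `|busemann u'|)%N%:Z)%R => v Kv.
have vE : v = iter (`|busemann v| - `|K1|) parent u.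
  rewrite -iterD subnK; last by lia.
  by apply: busemann_ge0; lia.
have N1 := tmap_shift_gt0 T1; have N2 := tmap_shift_gt0 T2.
split; [apply: S1|apply: S1|]; rewrite ?busemann_tmap; [lia|lia|].
rewrite vE => v' Pv; rewrite (spine_rel_fun hP Pv (Pk _)).
by apply: S2; rewrite busemann_tmap busemann_iter; lia.
Qed.

Lemma ext_rel_base u v' : P u v' -> Q u v' /\ forall v'', Q u v'' -> v'' = v'.
Proof.
move=> Pu; split=> [|v'']; first exact: ext_base.
move=> Qu; case: Qu Pu => [{}u {}v'' Pv|{}u {}v'' uS _ _ _] Pu.
  exact: (spine_rel_fun hP) Pv Pu.
by case: uS; apply: (spine_rel_dom hP) Pu.
Qed.

Lemma determined_near_spine v v' : P v v' -> Q (tmap v) (tmap v') -> determined v.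
Proof.
move=> Pv QF; have [Qv uniqv] := ext_rel_base Pv; exists v'; split=> //.
- exact: (spine_rel_spine hP) Pv.
- by apply: ext_base; apply: (spine_rel_parent hP) Pv.
Qed.

(** Let [u'] be the partner of [tmap v]. The iterates of [tmap v] and of [parent v] are higher than
    [v], so their partners are the iterates of [u'] and of [parent v'], and return times over the
    parents agree. At that time [u'] and [tmap v'] have the same image. Both are neighbours of
    [tmap (parent v')], whose orbit is off the spine until then, so they coincide. *)
Lemma ext_rel_tmap v v' : (forall u, (busemann v < busemann u)%R -> determined u) ->
  P v v' -> Q (tmap v) (tmap v').
Proof.
move=> IH Pv; have N1 := tmap_shift_gt0 T1.
have gF j : determined (iter j (@tmap R T1) (tmap v)).
  by apply: IH; have := busemann_iter_tmap j (tmap v); rewrite busemann_tmap; lia.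
have [u' [Qu uniqu uS Qpu QFu]] := gF 0.
have QFj j : Q (iter j (@tmap R T1) (tmap v)) (iter j (@tmap R T2) u').
  by elim: j => [//|j]; move=> /(determined_rel (gF j)) [].
have gFp j : determined (iter j (@tmap R T1) (parent v)).
  by apply: IH; have := busemann_iter_tmap j (parent v); rewrite busemann_parent; lia.
have Qp j : Q (iter j (@tmap R T1) (parent v)) (iter j (@tmap R T2) (parent v')).
  elim: j => [|j]; last by move=> /(determined_rel (gFp j)) [].
  by apply: ext_base; apply: (spine_rel_parent hP) Pv.
have pS j : in_spine (iter j (@tmap R T1) (parent v)) <->
    in_spine (iter j (@tmap R T2) (parent v')) by have [] := determined_rel (gFp j) (Qp j).
have pu : parent u' = tmap (parent v').
  by apply: (determined_uniq (gFp 1) _ (Qp 1)); rewrite /= tmap_parent.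
have [r0 rS rmin] := return_timeP (parent v).
have rE : return_time (parent v') = return_time (parent v).
  apply: return_timeE => // [|i ir]; first exact/pS.
  by move=> /pS; apply: rmin.
have := spine_rel_return_child hP Pv; rewrite rE.
case: (return_time _) r0 rS rmin rE => // s _ rS rmin rE.
rewrite !iterSr => /ext_base /(determined_uniq (gF s)) /(_ (QFj s)) e.
suff -> : tmap v' = u' by [].
apply: (@iter_tmap_nbr_inj _ _ s (tmap (parent v'))) e => [i si| |].
- by rewrite -iterSr => /pS; apply: rmin; lia.
- exact: tmap_nbr (nbr_parent _).
- by rewrite -pu nbr_parent.
Qed.

Lemma determined_off_spine v : (forall u, (busemann v < busemann u)%R -> determined u) ->
  ~ in_spine (parent v) -> determined v.
Proof.
move=> IH vS; have N1 := tmap_shift_gt0 T1.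
have gp : determined (parent v) by apply: IH; rewrite busemann_parent; lia.
have gF : determined (tmap v) by apply: IH; rewrite busemann_tmap; lia.
have gFp : determined (tmap (parent v)).
  by apply: IH; rewrite busemann_tmap busemann_parent; lia.
have [w' [Qw uniqw wS _ QFw]] := gp.
have [u' [Qu uniqu _ Qpu _]] := gF.
have pu : parent u' = tmap w'.
  by apply: determined_uniq gFp _ QFw; rewrite tmap_parent.
have [|v' v'w Fv'] := @tmap_nbr_surj R T2 w' u'; first by rewrite -pu nbr_parent.
(* The alternative [v' = parent w'] would put the image of [v'] above [tmap w'], while [u'] is below
   it. *)
have pv' : parent v' = w'.
  apply: (child_nbr v'w) => v'p; apply: (@parent_parent R T2 u').
  by rewrite pu -tmap_parent -v'p.
have w'S : ~ in_spine w' by move/wS.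
exists v'; split=> //.
- by apply: ext_step; rewrite ?pv' ?Fv'.
- move=> v'' Qv''; have [/(spine_rel_dom hP)//|[Qp QF]] :
      P v v'' \/ Q (parent v) (parent v'') /\ Q (tmap v) (tmap v'').
    by case: Qv'' => *; [left|right].
  apply: (@tmap_nbr_inj _ _ w') => //; first by rewrite -(uniqw _ Qp) nbr_parent.
  by rewrite Fv'; apply: uniqu.
- by split=> /in_spine_parent; rewrite ?pv'.
- by rewrite pv'.
- by rewrite Fv'.
Qed.

Lemma all_determined v : determined v.
Proof.
have [K highK] := spine_near_infinity.
suff main n : forall v, (K - n%:Z <= busemann v)%R -> determined v.
  apply: (main `|K - busemann v|%N); lia.
elim: n => [|n IH] {}v vn.
  have [vS vFS v'FS] := highK v ltac:(lia).
  have [v' Pv] := spine_rel_total hP (in_spine_parent vS).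
  apply: (determined_near_spine Pv).
  have := spine_rel_return hP vS Pv.
  rewrite (@return_timeE _ _ v 1) //; last by case=> [|[]].
  rewrite (@return_timeE _ _ v' 1) //; last by case=> [|[]].
  - exact: ext_base.
  - exact: v'FS.
have IH' u : (busemann v < busemann u)%R -> determined u by move=> vu; apply: IH; lia.
have [vS|nS] := pselect (in_spine (parent v)); last exact: determined_off_spine.
have [v' Pv] := spine_rel_total hP vS.
by apply: (determined_near_spine Pv); apply: ext_rel_tmap.
Qed.

End Totality.

Lemma spine_rel_extend (T1 T2 : mptree R) (P : T1 -> T2 -> Prop) : spine_rel P ->
  exists (f : T1 -> T2) (g : T2 -> T1), [/\ cancel f g, cancel g f,
    forall v v', P v v' -> f v = v',
    forall v, (in_spine v <-> in_spine (f v)) /\ f (parent v) = parent (f v) &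
    forall v, f (tmap v) = tmap (f v)].
Proof.
move=> hP; have hP' := spine_rel_sym hP.
have gd := all_determined hP; have gd' := all_determined hP'.
have /choice[f fP] v : exists v', ext_rel P v v' by have [v' []] := gd v; exists v'.
have /choice[g gP] v' : exists v, ext_rel P v v'.
  by have [v [/ext_rel_sym]] := gd' v'; exists v.
exists f, g; split=> [v|v'|v v' Pv|v|v].
- by apply: (determined_uniq (gd' (f v))); apply: ext_rel_sym; rewrite ?gP ?fP.
- by apply: (determined_uniq (gd (g v'))); [exact: fP|exact: gP].
- by apply: determined_uniq (gd v) _ _; [exact: fP|exact: ext_base].
- have [vS Qp _] := determined_rel (gd v) (fP v); split=> //.
  exact: determined_uniq (gd (parent v)) (fP _) Qp.
- have [_ _ QF] := determined_rel (gd v) (fP v).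
  exact: determined_uniq (gd (tmap v)) (fP _) QF.
Qed.

End Extension.

(** * Holomorphic isometries *)

Local Open Scope ring_scope.

Lemma derive1_comp_num (K : numFieldType) (f g : K -> K) x :
  derivable f x 1 -> derivable g (f x) 1 ->
  derivable (g \o f) x 1 /\ 'D_1 (g \o f) x = 'D_1 g (f x) * 'D_1 f x.
Proof.
move=> /derivable1_diffP df /derivable1_diffP dg.
have dgf := differentiable_comp df dg.
split; first exact/derivable1_diffP.
rewrite -!derive1E derive1E' // diff_comp // !derive1E' //= -[X in 'd  _ _ X = _]mulr1.
by rewrite [LHS]linearZ mulrC.
Qed.

(** A root of 1 + z + ... + z^(m-1) works: this polynomial takes the value m at 1, nonzero in
    characteristic 0. *)
Lemma unity_root_neq1 (K : numClosedFieldType) m : (1 < m)%N ->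
  exists z : K, z ^+ m = 1 /\ z <> 1.
Proof.
move=> m1; pose p : {poly K} := \poly_(i < m) 1.
have sp : size p = m.
  by apply: size_poly_eq; rewrite oner_eq0.
have : size p != 1%N by rewrite sp; lia.
move=> /closed_rootP[z]; rewrite /root horner_poly => /eqP z0.
exists z; split.
  apply/eqP; rewrite -subr_eq0 subrX1.
  by under eq_bigr do rewrite -[_ ^+ _]mul1r; rewrite z0 mulr0.
move=> z1; move: z0; rewrite z1; under eq_bigr do rewrite expr1n mulr1.
by rewrite sumr_const card_ord => /eqP; rewrite pnatr_eq0; lia.
Qed.

Section Charts.
Variables (R : realType) (X : surface R).
Implicit Types (phi psi : chart R X) (x : X).

Lemma continuous_cmap phi x : atlas phi -> cdom phi x -> {for x, continuous (cmap phi)}.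
Proof. by move=> /atlas_chart[_ _ _ c _] dx; apply: c; rewrite inE. Qed.

Lemma cmapK phi x : atlas phi -> cdom phi x -> cinv phi (cmap phi x) = x.
Proof. by move=> /atlas_chart[_ _ K _ _] dx; apply: K; rewrite inE. Qed.

Lemma near_cdom phi x : atlas phi -> cdom phi x -> \forall x' \near x, cdom phi x'.
Proof. by move=> /atlas_chart[od _ _ _ _] dx; apply: open_nbhs_nbhs. Qed.

Lemma cvg_cinv phi x : atlas phi -> cdom phi x ->
  cinv phi z @[z --> cmap phi x] --> x.
Proof.
move=> aphi dx; rewrite -[X in _ --> X](cmapK aphi dx).
case: (atlas_chart aphi) => _ _ _ _; apply; rewrite inE; exact: imageP.
Qed.

Lemma near_cmap phi x (P : C R -> Prop) : atlas phi -> cdom phi x ->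
  (\forall z \near cmap phi x, P z) -> \forall x' \near x, P (cmap phi x').
Proof. by move=> aphi dx Pz; apply: (continuous_cmap aphi dx). Qed.

Lemma near_cinv phi x (P : X -> Prop) : atlas phi -> cdom phi x ->
  (\forall x' \near x, P x') -> \forall z \near cmap phi x, P (cinv phi z).
Proof. by move=> aphi dx Px; apply: (cvg_cinv aphi dx). Qed.

Lemma near_cinvK phi x : atlas phi -> cdom phi x ->
  \forall z \near cmap phi x, cmap phi (cinv phi z) = z.
Proof.
move=> aphi dx; have [_ od _ _ _] := atlas_chart aphi.
have : nbhs (cmap phi x) (cmap phi @` cdom phi).
  by apply: open_nbhs_nbhs; split=> //; apply: imageP.
by apply: filterS => z [x' dx' <-]; rewrite cmapK.
Qed.

Lemma cmap_inj phi x x' : atlas phi -> cdom phi x -> cdom phi x' ->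
  cmap phi x = cmap phi x' -> x = x'.
Proof. by move=> aphi dx dx' e; rewrite -(cmapK aphi dx) e cmapK. Qed.

End Charts.

Section Holomorphic.
Variable R : realType.

Lemma in_charts_comp (X Y Z : surface R) (f : X -> Y) (k : Y -> Z) x phi chi psi :
  holomorphic f -> holomorphic k ->
  charts_at f x phi chi -> charts_at k (f x) chi psi ->
  derivable (in_charts (k \o f) phi psi) (cmap phi x) 1 /\
  'D_1 (in_charts (k \o f) phi psi) (cmap phi x) =
  'D_1 (in_charts k chi psi) (cmap chi (f x)) * 'D_1 (in_charts f phi chi) (cmap phi x).
Proof.
move=> [cf df] [_ dk] cfx ckx; have [aphi dphi achi dchi] := cfx.
have := @derive1_comp_num _ (in_charts f phi chi) (in_charts k chi psi) (cmap phi x).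
have fE : in_charts f phi chi (cmap phi x) = cmap chi (f x).
  by rewrite /in_charts /= cmapK.
rewrite fE => /(_ (df _ _ _ cfx) (dk _ _ _ ckx)) [dc <-].
have e : \forall z \near cmap phi x,
    (in_charts k chi psi \o in_charts f phi chi) z = in_charts (k \o f) phi psi z.
  have : \forall x' \near x, cdom chi (f x') by apply: cf; apply: near_cdom.
  move=> /(near_cinv aphi dphi); apply: filterS => z /= dz.
  by rewrite /in_charts /= cmapK.
split; first exact: near_eq_derivable e dc.
by apply/esym; apply: near_eq_derive.
Qed.

Lemma holomorphic_comp (X Y Z : surface R) (f : X -> Y) (k : Y -> Z) :
  holomorphic f -> holomorphic k -> holomorphic (k \o f).
Proof.
move=> hf hk; split=> [x|x phi psi [aphi dphi apsi dpsi]].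
  by apply: continuous_comp; [apply: hf.1|apply: hk.1].
have [chi achi dchi] := atlas_cover (f x).
have cf : charts_at f x phi chi by [].
have ck : charts_at k (f x) chi psi by [].
exact: (in_charts_comp hf hk cf ck).1.
Qed.

Lemma derive_in_charts_id (X : surface R) x (phi : chart R X) : atlas phi -> cdom phi x ->
  'D_1 (in_charts (@id X) phi phi) (cmap phi x) = 1.
Proof.
move=> aphi dphi; have e := near_cinvK aphi dphi.
rewrite (near_eq_derive (g := id)) ?derive_id //.
Qed.

(** If [f] reads as z^m in charts with m > 1, then z and w z have the same image for an m-th root of
    unity w other than 1; z is chosen nonzero and small enough for both points to stay in the
    charts. *)
Lemma mult_at_inj (X Y : surface R) (f : X -> Y) x m :
  continuous f -> injective f -> mult_at f x m -> m = 1%N.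
Proof.
move=> cf injf [m0 [phi [psi [[aphi dphi apsi dpsi] phi0 psi0 fE]]]].
have [m1|m1] := leqP m 1; first by lia.
have [w [wm w1]] := @unity_root_neq1 R[i] m m1.
have near0 : \forall z \near (0 : C R), cmap phi (cinv phi z) = z /\
   (cdom psi (f (cinv phi z)) /\ cmap psi (f (cinv phi z)) = z ^+ m).
  rewrite -phi0; have K := near_cinvK aphi dphi.
  have P : \forall x' \near x, cdom psi (f x') /\ cmap psi (f x') = cmap phi x' ^+ m.
    by apply: filterI => //; apply: cf; apply: near_cdom.
  move: K (near_cinv aphi dphi P) => /filterI h /h; apply: filterS => z /= [zK].
  by rewrite zK.
have cw : w * z @[z --> (0 : C R)] --> (0 : C R).
  by rewrite -[X in _ --> X](mulr0 w); apply: mulrl_continuous.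
have near0w := cw _ near0.
have near00 : \forall z \near ((0 : C R)^')%classic, z != 0 by exact: nbhs_dnbhs_neq.
have [z [[z0 [zK [dz ez]]] [wzK [dwz ewz]]]] :=
  filter_ex (filterI (filterI near00 (nbhs_dnbhs near0)) (nbhs_dnbhs near0w)).
have : f (cinv phi z) = f (cinv phi (w * z)).
  by apply: (cmap_inj apsi) => //; rewrite ez ewz exprMn wm mul1r.
move=> /injf /(congr1 (cmap phi)); rewrite zK wzK => zw.
by case: w1; apply: (mulIf z0); rewrite mul1r -zw.
Qed.

Section Inverse.
Variables (X Y : surface R) (f : X -> Y) (g : Y -> X).
Hypotheses (fK : cancel f g) (gK : cancel g f).

(** Multiplicity one supplies charts in which [f] reads as the identity, so [g] is explicit near
    [y]. *)
Lemma local_inverse (y : Y) : continuous f -> mult_at f (g y) 1 ->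
  exists phi psi, [/\ atlas phi, cdom phi (g y), atlas psi, cdom psi y &
   cmap phi (g y) = cmap psi y /\ \forall y' \near y, g y' = cinv phi (cmap psi y')].
Proof.
move=> cf [_ [phi [psi [[aphi dphi apsi dpsi] phi0 psi0 fE]]]].
rewrite gK in dpsi psi0; exists phi, psi; split=> //; split; first by rewrite phi0 psi0.
have P : \forall x' \near g y, cdom psi (f x') /\ cmap psi (f x') = cmap phi x'.
  by apply: filterI fE; apply: cf; rewrite gK; apply: near_cdom.
have := near_cinv aphi dphi P; have K := near_cinvK aphi dphi.
move=> /(filterI K); rewrite phi0 -psi0 => /(near_cmap apsi dpsi).
move=> /(filterI (near_cdom apsi dpsi)); apply: filterS => y' /= [dy' [yK [dfy ey]]].
rewrite -[RHS]fK; congr g; apply: (cmap_inj apsi) => //.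
by rewrite ey yK.
Qed.

Lemma holomorphic_inverse : continuous f -> (forall x, mult_at f x 1) -> holomorphic g.
Proof.
move=> cf mf; split=> [y|y psi phi [apsi dpsi aphi dphi]].
  have [phi [psi [aphi dphi apsi dpsi [e0 e]]]] := local_inverse cf (mf (g y)).
  have : cinv phi (cmap psi y') @[y' --> y] --> g y.
    apply: (@cvg_comp _ _ _ (cmap psi) (cinv phi) _ (nbhs (cmap psi y))).
      exact: continuous_cmap.
    by rewrite -e0; apply: cvg_cinv.
  by apply: cvg_trans; apply: near_eq_cvg; apply: filterS e => y' ->.
have [phi0 [psi0 [aphi0 dphi0 apsi0 dpsi0 [e0 e]]]] := local_inverse cf (mf (g y)).
(* In arbitrary charts the inverse becomes the composite of two transition maps. *)
pose t1 : C R -> C R := cmap psi0 \o cinv psi; pose t2 : C R -> C R := cmap phi \o cinv phi0.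
have t1E : t1 (cmap psi y) = cmap phi0 (g y) by rewrite /t1 /= cmapK // e0.
have [] := @derive1_comp_num _ t1 t2 (cmap psi y).
- exact: atlas_compat.
- by rewrite t1E; apply: atlas_compat.
move=> dt _; apply: near_eq_derivable dt.
have := near_cinv apsi dpsi e; apply: filterS => z /= ez.
by rewrite /in_charts /= ez.
Qed.

End Inverse.

Lemma holomorphic_id (X : surface R) : holomorphic (@id X).
Proof.
split=> [x|x phi psi [aphi dphi apsi dpsi]]; first exact: cvg_id.
exact: (atlas_compat aphi apsi dphi dpsi).
Qed.

Lemma holo_isometry_id (X : surface R) (eta : Defs.form X) : holo_isometry eta eta id.
Proof.
split; first by exists id; split=> //; apply: holomorphic_id.
move=> x phi psi [aphi dphi apsi dpsi].
exact: congr1 (esym (coef_change eta aphi apsi dphi dpsi)).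
Qed.

Lemma holo_isometry_comp (X Y Z : surface R)
  (eta : Defs.form X) (om : Defs.form Y) (th : Defs.form Z)
  (f : X -> Y) (k : Y -> Z) : holo_isometry eta om f -> holo_isometry om th k ->
  holo_isometry eta th (k \o f).
Proof.
move=> [[g [fK gK hf hg]] isof] [[l [kK lK hk hl]] isok]; split.
  exists (g \o l); split; [exact: can_comp|exact: can_comp| |]; exact: holomorphic_comp.
move=> x phi psi [aphi dphi apsi dpsi].
have [chi achi dchi] := atlas_cover (f x).
have cf : charts_at f x phi chi by [].
have ck : charts_at k (f x) chi psi by [].
have e1 := isof _ _ _ cf; have e2 := isok _ _ _ ck.
rewrite /pullback_coef (in_charts_comp hf hk cf ck).2 mulrA normrM.
by rewrite [X in X * _ = _]e2 -normrM.
Qed.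

Lemma holo_isometry_inv (X Y : surface R) (eta : Defs.form X) (om : Defs.form Y)
  (f : X -> Y) (g : Y -> X) : cancel f g -> cancel g f ->
  holo_isometry eta om f -> holo_isometry om eta g.
Proof.
move=> fK gK [[g' [fK' gK' hf hg']] isof].
have {g' fK' gK' hg'} hg : holomorphic g.
  by have -> : g = g' by apply/funext => y; rewrite -{2}(gK y) fK'.
split; first by exists f.
move=> y psi phi [apsi dpsi aphi dphi].
have cg : charts_at g y psi phi by [].
have cf : charts_at f (g y) phi psi by split; rewrite ?gK.
have e1 := isof _ _ _ cf; rewrite /pullback_coef gK in e1.
have [_] := in_charts_comp hg hf cg cf.
have -> : f \o g = id by apply/funext.
rewrite derive_in_charts_id // => d1.
by rewrite /pullback_coef normrM -[X in X * _ = _]e1 -normrM -mulrA -d1 mulr1.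
Qed.

(** By injectivity each fibre is one point of multiplicity 1, so the factor 1/n in the definition of
    a local model map is 1 and the form itself is pulled back. *)
Lemma local_model_map_isometry (X Y : local_model R) (f : X -> Y) :
  local_model_map f -> injective f -> (forall x, mult_at f x 1) ->
  holo_isometry (lm_form X) (lm_form Y) f.
Proof.
move=> [n [[n0 hf fib] pull _]] injf mf.
have surjf y : exists x, f x = y.
  have [s [m [_ sE _ sn]]] := fib y; case: s sE sn => [|x s] sE sn.
    by rewrite big_nil in sn; rewrite -sn in n0.
  by exists x; have [] := (sE x).1 (mem_head x s).
have [g gK] := choice surjf.
have fK : cancel f g by move=> x; apply: injf.
split; first by exists g; split=> //; apply: holomorphic_inverse mf; case: hf.
move=> x phi psi c; rewrite (pull _ _ _ c).
suff -> : n = 1%N by rewrite invr1 mul1r.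
have [s [m [us sE ms sn]]] := fib (f x).
have : perm_eq s [:: x].
  apply: uniq_perm => // x'; rewrite inE; apply/idP/eqP => [/sE[_ /injf]//|->].
  exact/sE.
move=> s1; rewrite -sn (perm_big _ s1) big_seq1.
apply: (mult_at_inj (x := x) hf.1 injf); apply: ms; exact/sE.
Qed.

End Holomorphic.

(** * The path metric near a vertex *)

Section TreeDist.
Variables (R : realType) (T : mptree R).
Implicit Types (u v w a c : T) (x y z : tree_pt T).

Definition descends c v : Prop := exists k, iter k parent v = c.

Lemma descends_parent c v : descends c v <-> v = c \/ descends c (parent v).
Proof.
split=> [[[|k] /= e]|[->|[k e]]]; [by left| |by exists 0%N|].
  by right; exists k; rewrite -e -iterSr.
by exists k.+1; rewrite iterSr.
Qed.

Lemma not_descends_parent c : ~ descends c (parent c).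
Proof. by move=> [k]; rewrite -iterSr => /(@iter_parent_inj _ _ _ k.+1 0%N). Qed.

(* The retraction of the tree onto the edge from [c] to its parent: its
   coordinates are Lipschitz and bound [tree_dist] from below. *)
Definition collapse c v : T := if `[< descends c v >] then c else parent c.

Lemma collapse_parent c v : v <> c -> collapse c (parent v) = collapse c v.
Proof.
move=> vc; rewrite /collapse; suff -> : descends c v = descends c (parent v) by [].
by apply/propext; rewrite descends_parent; split=> [[]|]; tauto.
Qed.

Lemma collapse_self c : collapse c c = c.
Proof. by rewrite /collapse ifT //; apply/asboolP; exists 0%N. Qed.

Lemma collapse_self_parent c : collapse c (parent c) = parent c.
Proof. by rewrite /collapse ifF //; apply/asboolPn; apply: not_descends_parent. Qed.

Lemma collapse_simplicial c : simplicial (collapse c).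
Proof.
have par v : simplex (collapse c v) (collapse c (parent v)) /\
             simplex (collapse c (parent v)) (collapse c v).
  have [->|vc] := pselect (v = c); last by rewrite collapse_parent //; split; left.
  rewrite collapse_self collapse_self_parent.
  by split; right; rewrite ?parent_nbr ?nbr_parent.
move=> u w [->|/nbrP[->|<-]]; [by left|exact: (par u).1|exact: (par w).2].
Qed.

(** The distance from [parent c] to the retracted point: the full length at [c] and below, 0 on the
    part of the tree beyond [parent c]. *)
Definition edge_coord c x : R :=
  len c (parent c) * Defs.coord (geo_map (collapse_simplicial c) x) c.

Lemma edge_coord_self c x (t : R) : Defs.coord x = bary c (parent c) t ->
  edge_coord c x = len c (parent c) * (1 - t).
Proof.
move=> xE; rewrite /edge_coord (coord_geo_map _ xE) collapse_self collapse_self_parent.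
by rewrite bary_start //; apply: nbr_neq (parent_nbr c).
Qed.

Lemma edge_coord_cst c v x y (t s : R) : v <> c -> Defs.coord x = bary v (parent v) t ->
  Defs.coord y = bary v (parent v) s -> edge_coord c x = edge_coord c y.
Proof.
move=> vc xE yE; rewrite /edge_coord (coord_geo_map _ xE) (coord_geo_map _ yE).
by rewrite collapse_parent // bary_same [in RHS]bary_same.
Qed.

Lemma edge_metric_stepP x y l : edge_metric_step (len (m := T)) x y l -> exists v t s,
  [/\ Defs.coord x = bary v (parent v) t, Defs.coord y = bary v (parent v) s &
      l = len v (parent v) * `|t - s|].
Proof.
move=> [u [w [t [s [wu [_ _ xE] [_ _ yE] ->]]]]].
case/nbrP: (wu) => [wE|uE]; first by exists u, t, s; rewrite -wE.
exists w, (1 - t), (1 - s); rewrite uE -!bary_swap; split=> //.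
rewrite len_sym //; congr (_ * _); rewrite distrC; congr `|_|; ring.
Qed.

Lemma edge_coord_step c x y l : edge_metric_step (len (m := T)) x y l ->
  `|edge_coord c x - edge_coord c y| <= l.
Proof.
move=> /edge_metric_stepP[v [t [s [xE yE ->]]]]; have l0 := len_gt0 (parent_nbr v).
have [vc|vc] := pselect (v = c); last first.
  by rewrite (edge_coord_cst vc xE yE) subrr normr0 mulr_ge0 // ltW.
rewrite vc in xE yE l0 *; rewrite (edge_coord_self xE) (edge_coord_self yE) -mulrBr normrM.
rewrite gtr0_norm // distrC ler_pM2l //.
by have -> : 1 - s - (1 - t) = t - s by ring.
Qed.

(** A step moves along one edge and changes at most one of the two coordinates, so a signed sum
    stays 1-Lipschitz. It will measure paths through a vertex. *)
Lemma edge_coord2_step c c' (e e' : R) x y l : c <> c' -> `|e| = 1 -> `|e'| = 1 ->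
  edge_metric_step (len (m := T)) x y l ->
  `|(e * edge_coord c x + e' * edge_coord c' x) - (e * edge_coord c y + e' * edge_coord c' y)| <= l.
Proof.
move=> cc' e1 e1' st; have [v [t [s [xE yE _]]]] := edge_metric_stepP st.
have -> : e * edge_coord c x + e' * edge_coord c' x - (e * edge_coord c y + e' * edge_coord c' y)
  = e * (edge_coord c x - edge_coord c y) + e' * (edge_coord c' x - edge_coord c' y) by ring.
have [vc|vc] := pselect (v = c).
  have vc' : v <> c' by rewrite vc.
  rewrite (edge_coord_cst vc' xE yE) subrr mulr0 addr0 normrM e1 mul1r.
  exact: edge_coord_step.
rewrite (edge_coord_cst vc xE yE) subrr mulr0 add0r normrM e1' mul1r.
exact: edge_coord_step.
Qed.

Lemma chain_lipschitz (H : tree_pt T -> R) x y l :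
  (forall x y l, edge_metric_step (len (m := T)) x y l -> `|H x - H y| <= l) ->
  chain (edge_metric_step (len (m := T))) x y l -> `|H x - H y| <= l.
Proof.
move=> stepH; elim=> [z|x' y' z c l' st _ IH]; first by rewrite subrr normr0.
have -> : H x' - H z = (H x' - H y') + (H y' - H z) by ring.
by apply: le_trans (ler_normD _ _) _; apply: lerD => //; apply: stepH.
Qed.

Lemma tree_dist_ge (H : tree_pt T -> R) x y l :
  (forall x y l, edge_metric_step (len (m := T)) x y l -> `|H x - H y| <= l) ->
  chain (edge_metric_step (len (m := T))) x y l -> `|H x - H y| <= tree_dist x y.
Proof.
move=> stepH xy; apply: lb_le_inf; first by exists l.
by move=> l' xy'; apply: chain_lipschitz xy'.
Qed.

Lemma tree_dist_le x y l :
  chain (edge_metric_step (len (m := T))) x y l -> tree_dist x y <= l.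
Proof.
move=> xy; apply: ge_inf => //; exists 0 => l' xy'.
have := @chain_lipschitz (fun _ => 0) x y l' _ xy'; rewrite subrr normr0; apply.
move=> x' y' c /edge_metric_stepP[v [t [s [_ _ ->]]]]; rewrite mulr_ge0 //.
by rewrite ltW // len_gt0 // parent_nbr.
Qed.

(** Edges are indexed by their lower end. With [edge_sign], the coordinate of the edge from [w] to
    [v] increases away from [w], whether [v] is the parent or a child of [w]. *)
Definition lower_end w v := if v == parent w then w else v.
Definition edge_sign w v : R := if v == parent w then -1 else 1.

Lemma norm_edge_sign w v : `|edge_sign w v| = 1.
Proof. by rewrite /edge_sign; case: ifP; rewrite ?normrN normr1. Qed.

Lemma edge_coord_bary w v u x z (t : R) : v \in nbr w -> u \in nbr w ->
  Defs.coord x = bary w u t -> Defs.coord z = bary w w 0 ->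
  edge_sign w v * edge_coord (lower_end w v) x =
  edge_sign w v * edge_coord (lower_end w v) z + (u == v)%:R * t * len w v.
Proof.
move=> vw uw xE zE; rewrite /edge_sign /lower_end.
have zp : Defs.coord z = bary w (parent w) 0 by rewrite zE !bary0.
have xu : parent u = w -> Defs.coord x = bary u (parent u) (1 - t).
  by move=> pu; rewrite -bary_swap pu.
have zu a : parent a = w -> Defs.coord z = bary a (parent a) 1.
  by move=> pa; rewrite bary_swap subrr pa zE !bary0.
case: eqP => [vp|vp].
  have [uv|/eqP uv] /= := eqVneq u v.
    by rewrite uv vp in xE; rewrite (edge_coord_self xE) (edge_coord_self zp) vp; ring.
  have pu : parent u = w by apply: (child_nbr uw); rewrite -vp.
  rewrite (edge_coord_cst _ (xu pu) (zu _ pu)); first by ring.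
  exact: nbr_neq.
have pv := child_nbr vw vp.
have lv : len v (parent v) = len w v by rewrite pv len_sym // nbrC.
have [uv|/eqP uv] /= := eqVneq u v.
  by rewrite uv in xu; rewrite (edge_coord_self (xu pv)) (edge_coord_self (zu _ pv)) lv; ring.
have [up|up] := pselect (u = parent w).
  rewrite up in xE; rewrite (edge_coord_cst _ xE zp); first by ring.
  by move=> wv; move: vw; rewrite wv (negbTE (nbr_irr _)).
have pu := child_nbr uw up.
by rewrite (edge_coord_cst _ (xu pu) (zu _ pu)) //; ring.
Qed.

Lemma chain_step x y l : edge_metric_step (len (m := T)) x y l ->
  chain (edge_metric_step (len (m := T))) x y l.
Proof. by move=> st; rewrite -[l]addr0; apply: chain_cons st (chain_nil _ _). Qed.

Lemma edge_step w v x y (t s : R) : v \in nbr w -> 0 <= t <= 1 -> 0 <= s <= 1 ->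
  Defs.coord x = bary w v t -> Defs.coord y = bary w v s ->
  edge_metric_step (len (m := T)) x y (len w v * `|t - s|).
Proof. by move=> vw t01 s01 xE yE; exists w, v, t, s; split=> //; split=> //; right. Qed.

Lemma tree_dist_edge w v x y (t s : R) : v \in nbr w -> 0 <= t <= 1 -> 0 <= s <= 1 ->
  Defs.coord x = bary w v t -> Defs.coord y = bary w v s ->
  tree_dist x y = len w v * `|t - s|.
Proof.
move=> vw t01 s01 xE yE; have st := chain_step (edge_step vw t01 s01 xE yE).
apply/eqP; rewrite eq_le tree_dist_le //=.
have [z zE] := vertex_pt w.
apply: le_trans (tree_dist_ge (@edge_coord_step (lower_end w v)) st).
have := edge_coord_bary vw vw xE zE; have := edge_coord_bary vw vw yE zE.
rewrite eqxx !mul1r => e1 e2.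
rewrite -[X in _ <= X]mul1r -(norm_edge_sign w v) -normrM mulrBr e1 e2.
set A := edge_sign w v * _.
have -> : A + t * len w v - (A + s * len w v) = len w v * (t - s) by ring.
by rewrite normrM gtr0_norm ?len_gt0.
Qed.

Lemma tree_dist_star w v u x y (t s : R) : v \in nbr w -> u \in nbr w -> v <> u ->
  0 <= t <= 1 -> 0 <= s <= 1 ->
  Defs.coord x = bary w v t -> Defs.coord y = bary w u s ->
  tree_dist x y = t * len w v + s * len w u.
Proof.
move=> vw uw vu t01 s01 xE yE; have [z zE] := vertex_pt w.
have z01 : 0 <= (0 : R) <= 1 by rewrite lexx ler01.
have zv : Defs.coord z = bary w v 0 by rewrite zE !bary0.
have zu : Defs.coord z = bary w u 0 by rewrite zE !bary0.
have st := chain_cons (edge_step vw t01 z01 xE zv) (chain_step (edge_step uw z01 s01 zu yE)).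
have lv := len_gt0 vw; have lu := len_gt0 uw.
apply/eqP; rewrite eq_le; apply/andP; split.
  apply: le_trans (tree_dist_le st) _.
  rewrite subr0 sub0r normrN !ger0_norm; [|lra|lra].
  by rewrite mulrC [len w u * _]mulrC.
have cc' : lower_end w v <> lower_end w u.
  rewrite /lower_end; case: eqP => [vp|vp]; case: eqP => [up|up] //.
  - by move: vu; rewrite vp up.
  - by move=> wu; move: uw; rewrite -wu (negbTE (nbr_irr _)).
  - by move=> wv; move: vw; rewrite wv (negbTE (nbr_irr _)).
(* The second sign is reversed so that the two coordinate differences between [x] and [y] add up. *)
have n1 : `|- edge_sign w u| = 1 by rewrite normrN norm_edge_sign.
apply: le_trans (tree_dist_ge
  (fun x y l => @edge_coord2_step _ _ _ _ x y l cc' (norm_edge_sign w v) n1) st).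
have vu1 : (u == v) = false by apply/eqP => e; apply: vu.
have vu2 : (v == u) = false by apply/eqP.
have := edge_coord_bary vw vw xE zE; have := edge_coord_bary uw vw xE zE.
have := edge_coord_bary vw uw yE zE; have := edge_coord_bary uw uw yE zE.
rewrite !eqxx vu1 vu2 !mulNr => -> -> -> -> /=.
apply: le_trans (ler_norm _); rewrite le_eqVlt; apply/orP; left; apply/eqP; ring.
Qed.

End TreeDist.

(** * Isometries of the stars of the spine *)

Section StarIso.
Variable R : realType.

Record star_iso (T1 T2 : mptree R) (f : T1 -> T2) (sigma : tree_pt T1 -> tree_pt T2) : Prop :=
 StarIso {
  star_iso_spine : forall v, in_spine v -> in_spine (f v);
  star_iso_fun_inj : forall u v, in_spine u -> in_spine v -> f u = f v -> u = v;
  star_iso_fun_surj : forall v', in_spine v' -> exists2 v, in_spine v & f v = v';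
  star_iso_star : forall v, in_spine v -> sigma @` star v = star (f v);
  star_iso_inj : forall x y, spine_stars x -> spine_stars y -> sigma x = sigma y -> x = y;
  star_iso_dist : forall x y, spine_stars x -> spine_stars y ->
    tree_dist (sigma x) (sigma y) = tree_dist x y }.

Lemma star_meet (T : graph) (u v : T) (x : geo T R) : star u x -> star v x -> u <> v ->
  u \in nbr v.
Proof.
have [a [b [t [ab t01 xE]]]] := coordP x.
rewrite /star /= xE => ux vx uv.
have ends c : 0 < bary a b t c -> c = a \/ c = b.
  move=> c0; apply: contrapT => /not_orP[ca cb].
  by rewrite bary_neq // ltxx in c0.
have {}ab : b \in nbr a.
  case: ab => // ba; case: uv.
  by case: (ends _ ux) => ->; case: (ends _ vx) => ->; rewrite ?ba.
by move: uv; case: (ends _ ux) => ->; case: (ends _ vx) => -> // _; rewrite nbrC.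
Qed.

Lemma in_spine_stars (T : mptree R) (v : T) x : in_spine v -> star v x -> spine_stars x.
Proof. by move=> vS vx; exists v. Qed.

Lemma edge_pt (T : graph) (v a : T) (t : R) : a \in nbr v -> 0 <= t <= 1 ->
  exists x : geo T R, Defs.coord x = bary v a t.
Proof. by move=> av; apply: geo_ex; right. Qed.

Lemma star_iso_inv (T1 T2 : mptree R) (f : T1 -> T2) sigma : star_iso f sigma ->
  exists g tau, [/\ @star_iso T2 T1 g tau, forall v, in_spine v -> g (f v) = v,
    forall v', in_spine v' -> f (g v') = v' &
    forall x, spine_stars x -> tau (sigma x) = x].
Proof.
move=> [fS finj fsurj fstar sinj sdist].
have [x0 _] := vertex_pt (top T1).
have /choice[g gP] v' : exists v, in_spine v' -> in_spine v /\ f v = v'.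
  have [/fsurj[v vS fv]|nS] := pselect (in_spine v'); first by exists v.
  by exists (top T1).
have /choice[tau tauP] y : exists x, spine_stars y -> spine_stars x /\ sigma x = y.
  have [[v' v'S yv']|ny] := pselect (spine_stars y); last by exists x0.
  have [v vS fv] := fsurj _ v'S; move: yv'; rewrite -fv -fstar // => -[x xv <-].
  by exists x => _; split=> //; apply: in_spine_stars xv.
have sstar v x : in_spine v -> star v x -> star (f v) (sigma x).
  by move=> vS vx; rewrite -fstar //; exists x.
have sS x : spine_stars x -> spine_stars (sigma x).
  by move=> [v vS xv]; apply: in_spine_stars (fS _ vS) (sstar _ _ vS xv).
have gf v : in_spine v -> g (f v) = v.
  by move=> vS; have [gS] := gP _ (fS _ vS); apply: finj.
have ts x : spine_stars x -> tau (sigma x) = x.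
  by move=> xS; have [tS] := tauP _ (sS _ xS); apply: sinj.
exists g, tau; split=> // [|v' /gP[]//].
split.
- by move=> v /gP[].
- by move=> u v uS vS guv; rewrite -(gP _ uS).2 guv (gP _ vS).2.
- by move=> v vS; exists (f v); [exact: fS|exact: gf].
- move=> v' v'S; have [gS fg] := gP _ v'S; apply/seteqP; split=> [x [y yv <-]|x xv].
    have {}yv : star (f (g v')) y by rewrite fg.
    move: yv; rewrite -fstar // => -[z zv <-].
    by rewrite ts //; apply: in_spine_stars zv.
  exists (sigma x); first by rewrite -fg; apply: sstar.
  by rewrite ts //; apply: in_spine_stars xv.
- by move=> x y /tauP[_ sx] /tauP[_ sy] e; rewrite -sx -sy e.
- by move=> x y /tauP[xS sx] /tauP[yS sy]; rewrite -sdist // sx sy.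
Qed.

Section Star.
Variables (T1 T2 : mptree R) (f : T1 -> T2) (sigma : tree_pt T1 -> tree_pt T2).
Hypothesis iso : star_iso f sigma.
Implicit Types (u v w a : T1) (x y : tree_pt T1) (t : R).

Lemma star_iso_in v x : in_spine v -> star v x -> star (f v) (sigma x).
Proof. by move=> vS vx; rewrite -(star_iso_star iso) //; exists x. Qed.

Lemma star_iso_nbr u v : in_spine u -> in_spine v -> u \in nbr v -> f u \in nbr (f v).
Proof.
move=> uS vS uv; have uNv := nbr_neq uv.
have [|x xE] := @edge_pt T1 v u 2^-1 uv; first lra.
have xv : star v x by apply/(star_bary uNv xE); lra.
have xu : star u x by apply/(star_bary_end uNv xE); lra.
apply: star_meet (star_iso_in uS xu) (star_iso_in vS xv) _.
by move=> /(star_iso_fun_inj iso uS vS).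
Qed.

Lemma star_iso_nonstar u x : in_spine u -> spine_stars x -> ~ star u x -> ~ star (f u) (sigma x).
Proof.
move=> uS xS nx; rewrite -(star_iso_star iso) // => -[y yu] /(star_iso_inj iso _ xS) e.
by apply: nx; rewrite -e //; apply: in_spine_stars yu.
Qed.

Lemma spine_nbr v : in_spine v -> exists2 u, in_spine u & u \in nbr v.
Proof. by move=> vS; exists (parent v); [exact: in_spine_parent|exact: parent_nbr]. Qed.

Lemma star_edge (v u : T2) (y : tree_pt T2) : u \in nbr v -> star v y -> star u y ->
  exists s : R, 0 < s < 1 /\ Defs.coord y = bary v u s.
Proof.
move=> uv yv yu; have [b [s [bv s01 yE]]] := starP (has_nbr v) yv.
have bu : b = u.
  apply: contrapT => bu; move: yu; rewrite /star /= yE bary_neq ?ltxx //.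
  - exact: nbr_neq.
  - exact/nesym.
exists s; rewrite -bu yE; split=> //; rewrite -bu in yu.
by have := (star_bary_end (nbr_neq bv) yE).1 yu; lra.
Qed.

(** Suppose [v] goes to a point at distance [l > 0] from [f v], on the edge to [b]. Take [y] near
    [v] on the edge to a spine neighbour [u], where stars are controlled. As stars are preserved,
    [b <> f u] and the image of [y] is on the edge to [f u], farther than [l] from that of [v]. *)
Lemma star_iso_vertex v x : in_spine v -> Defs.coord x = bary v v 0 ->
  Defs.coord (sigma x) = bary (f v) (f v) 0.
Proof.
move=> vS xE; have [u uS uv] := spine_nbr vS; have uNv := nbr_neq uv.
have xv : star v x by rewrite /star /= xE bary0 eqxx.
have xS := in_spine_stars vS xv.
have nxu : ~ star u x.
  by rewrite /star /= xE bary0 => /negP; apply; move/eqP/negbTE: uNv => ->; rewrite ltxx.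
have [b [s [bv s01 sxE]]] := starP (has_nbr (f v)) (star_iso_in vS xv).
have [s0|s0] := eqVneq s 0; first by rewrite sxE s0 !bary0.
have {}s0 : 0 < s by rewrite lt_neqAle eq_sym s0; lra.
have bu : b <> f u.
  move=> e; apply: (star_iso_nonstar uS xS nxu); rewrite -e.
  exact/(star_bary_end (nbr_neq bv) sxE).
have l1 := len_gt0 bv; have l2 := len_gt0 uv.
pose l := s * len (f v) b; have l0 : 0 < l by rewrite mulr_gt0.
(* 1/2 keeps [y] inside the edge, the other bound puts it within [l / 2] of [v]. *)
pose r := Num.min 2^-1 (l / (2 * len v u)).
have r0 : 0 < r by rewrite lt_min invr_gt0 ltr0n /= divr_gt0 // mulr_gt0.
have r1 : r <= 2^-1 by rewrite ge_min lexx.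
have rl : len v u * r <= l / 2.
  rewrite mulrC -ler_pdivlMr // ge_min; apply/orP; right.
  by rewrite invfM mulrA.
have [|y yE] := @edge_pt T1 v u r uv; first lra.
have yv : star v y by apply/(star_bary uNv yE); lra.
have yu : star u y by apply/(star_bary_end uNv yE).
have fuv := star_iso_nbr uS vS uv.
have [s' [s'01 syE]] := star_edge fuv (star_iso_in vS yv) (star_iso_in uS yu).
have xE0 : Defs.coord x = bary v u 0 by rewrite xE !bary0.
have := star_iso_dist iso xS (in_spine_stars vS yv).
rewrite (tree_dist_star bv fuv bu _ _ sxE syE); [|lra|lra].
rewrite (tree_dist_edge uv _ _ xE0 yE); [|lra|lra].
rewrite sub0r normrN gtr0_norm // -/l => e.
have p : 0 < s' * len (f v) (f u) by rewrite mulr_gt0 ?(len_gt0 fuv) //; lra.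
suff : (0 : R) < 0 by rewrite ltxx.
lra.
Qed.

(** Distances to the image of [v] are kept. The midpoint fixes the image edge: a point with
    parameter t > 0 sent to another edge would be (t + 1/2) lengths away from its image, against |t
    - 1/2| before. *)
Lemma star_iso_edge v a : in_spine v -> a \in nbr v -> exists a' : T2,
  a' \in nbr (f v) /\ forall t x, 0 <= t < 1 -> Defs.coord x = bary v a t ->
  exists t', [/\ 0 <= t' < 1, t' * len (f v) a' = t * len v a &
    Defs.coord (sigma x) = bary (f v) a' t'].
Proof.
move=> vS av; have aNv := nbr_neq av; have la := len_gt0 av.
have [z zE] := vertex_pt v; have szE := star_iso_vertex vS zE.
have in_star t x : 0 <= t < 1 -> Defs.coord x = bary v a t -> star v x.
  by move=> t01 xE; apply/(star_bary aNv xE); lra.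
have zS : spine_stars z by apply: (in_spine_stars vS); rewrite /star /= zE bary0 eqxx.
have im t x : 0 <= t < 1 -> Defs.coord x = bary v a t -> exists (a' : T2) t',
  [/\ a' \in nbr (f v), 0 <= t' < 1, t' * len (f v) a' = t * len v a
   & Defs.coord (sigma x) = bary (f v) a' t'].
  move=> t01 xE; have xv := in_star _ _ t01 xE.
  have [a' [t' [a'v t'01 sxE]]] := starP (has_nbr (f v)) (star_iso_in vS xv).
  exists a', t'; split=> //.
  have z1 : Defs.coord z = bary v a 0 by rewrite zE !bary0.
  have z2 : Defs.coord (sigma z) = bary (f v) a' 0 by rewrite szE !bary0.
  have := star_iso_dist iso (in_spine_stars vS xv) zS.
  rewrite (tree_dist_edge a'v _ _ sxE z2); [|lra|lra].
  rewrite (tree_dist_edge av _ _ xE z1); [|lra|lra].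
  by rewrite !subr0 !ger0_norm; [|lra|lra]; rewrite mulrC [len v a * _]mulrC.
have [|x0 x0E] := @edge_pt T1 v a 2^-1 av; first lra.
have h01 : 0 <= (2^-1 : R) < 1 by lra.
have [a' [t0 [a'v t001 l0 sx0]]] := im _ _ h01 x0E.
exists a'; split=> // t x t01 xE.
have [a'' [t' [a''v t'01 l' sx]]] := im _ _ t01 xE.
have [t00|t00] := eqVneq t 0.
  exists 0; rewrite t00 !mul0r; split=> //; first lra.
  have : t' * len (f v) a'' = 0 by rewrite l' t00 mul0r.
  by move=> /eqP; rewrite mulf_eq0 (gt_eqF (len_gt0 a''v)) orbF => /eqP t'0; rewrite sx t'0 !bary0.
have {}t00 : 0 < t by rewrite lt_neqAle eq_sym t00; lra.
have [e|ne] := pselect (a'' = a'); first by exists t'; rewrite -e.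
have := star_iso_dist iso (in_spine_stars vS (in_star _ _ t01 xE))
  (in_spine_stars vS (in_star _ _ h01 x0E)).
rewrite (tree_dist_star a''v a'v ne _ _ sx sx0); [|lra|lra].
rewrite (tree_dist_edge av _ _ xE x0E); [|lra|lra].
rewrite l' l0 -mulrDl mulrC => /(mulfI (lt0r_neq0 la)) e.
have : `|t - 2^-1| < t + 2^-1 by rewrite ltr_norml; lra.
by rewrite -e ltxx.
Qed.

End Star.

Section Nbr.
Variables (T1 T2 : mptree R) (f : T1 -> T2) (sigma : tree_pt T1 -> tree_pt T2).
Hypothesis iso : star_iso f sigma.

(** The half-open edge goes into the half-open edge with distances to the vertex kept, so its length
    is at most that of the image edge; the inverse isometry gives the converse. *)
Lemma star_iso_bary v a : in_spine v -> a \in nbr v -> exists a' : T2,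
  [/\ a' \in nbr (f v), len (f v) a' = len v a & forall t x, 0 <= t < 1 ->
  Defs.coord x = bary v a t -> Defs.coord (sigma x) = bary (f v) a' t].
Proof.
move=> vS av; have [a' [a'v im]] := star_iso_edge iso vS av.
have [g [tau [iso' gf fg ts]]] := star_iso_inv iso.
have [b [bv im']] := star_iso_edge iso' (star_iso_spine iso vS) a'v.
rewrite gf // in bv im'.
(* If [q < p], the point at distance [q] would have to go to the excluded parameter 1. *)
have bound (p q : R) : 0 < p -> 0 < q ->
    (forall t, 0 <= t < 1 -> exists2 t', 0 <= t' < 1 & t' * q = t * p) -> p <= q.
  move=> p0 q0 H; rewrite leNgt; apply/negP => qp.
  have [|t' t'1] := H (q / p).
    by rewrite divr_ge0 ?ltW //= ltr_pdivrMr // mul1r.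
  rewrite mulfVK ?gt_eqF // => e.
  have : t' * q < q by rewrite gtr_pMl //; lra.
  by rewrite e ltxx.
have ba : b = a.
  have [|x xE] := @edge_pt T1 v a 2^-1 av; first lra.
  have h01 : 0 <= (2^-1 : R) < 1 by lra.
  have [t' [t'01 _ sxE]] := im _ _ h01 xE.
  have [t'' [_ _]] := im' _ _ t'01 sxE.
  rewrite ts; last by apply: (in_spine_stars vS); apply/(star_bary (nbr_neq av) xE); lra.
  rewrite xE => /(bary_inj (nbr_neq av) (nbr_neq bv)) [_ e]; apply/esym/e.
  by rewrite invr_eq0 pnatr_eq0.
rewrite {}ba in bv im'.
have le1 : len v a <= len (f v) a'.
  apply: bound (len_gt0 av) (len_gt0 a'v) _ => t t01.
  have [|x xE] := @edge_pt T1 v a t av; first lra.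
  by have [t' [? ? _]] := im _ _ t01 xE; exists t'.
have le2 : len (f v) a' <= len v a.
  apply: bound (len_gt0 a'v) (len_gt0 av) _ => t t01.
  have [|x xE] := @edge_pt T2 (f v) a' t a'v; first lra.
  by have [t' [? ? _]] := im' _ _ t01 xE; exists t'.
have le : len (f v) a' = len v a by apply/eqP; rewrite eq_le le1 le2.
exists a'; split=> // t x t01 xE; have [t' [_ e ->]] := im _ _ t01 xE.
by move: e; rewrite le => /(mulIf (lt0r_neq0 (len_gt0 av))) ->.
Qed.

End Nbr.
End StarIso.

Lemma iter_tree_map_bary (R : realType) (T : mptree R) n (u w : T) (t : R) x :
  Defs.coord x = bary u w t ->
  Defs.coord (iter n (@tree_map R T) x) = bary (iter n (@tmap R T) u) (iter n (@tmap R T) w) t.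
Proof. by move=> xE; elim: n => [//|n IH]; apply: (coord_geo_map _ IH). Qed.

(** * From the isometry on stars to a relation between vertices *)

Section SpineRel.
Variables (R : realType) (T1 T2 : mptree R) (f : T1 -> T2) (sigma : tree_pt T1 -> tree_pt T2).
Hypothesis iso : star_iso f sigma.
Hypothesis conj_return : forall w x, in_spine w -> star w x ->
  sigma (iter (return_time w) (@tree_map R T1) x) =
  iter (return_time (f w)) (@tree_map R T2) (sigma x).

Lemma nbr_map_ex (v a : T1) : exists a' : T2, in_spine v -> a \in nbr v ->
  [/\ a' \in nbr (f v), len (f v) a' = len v a & forall t x, 0 <= t < 1 ->
  Defs.coord x = bary v a t -> Defs.coord (sigma x) = bary (f v) a' t].
Proof.
have [vS|nS] := pselect (in_spine v); last by exists (f v).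
have [av|nav] := boolP (a \in nbr v); last by exists (f v).
by have [a' a'P] := star_iso_bary iso vS av; exists a'.
Qed.

(** The action of [sigma] on the edges at a spine vertex, including those leading out of the spine,
    where [f] is not controlled. *)
Definition nbr_map v a := projT1 (cid (nbr_map_ex v a)).

Lemma nbr_map_nbr v a : in_spine v -> a \in nbr v -> nbr_map v a \in nbr (f v).
Proof. by move=> vS av; have [] := projT2 (cid (nbr_map_ex v a)) vS av. Qed.

Lemma len_nbr_map v a : in_spine v -> a \in nbr v -> len (f v) (nbr_map v a) = len v a.
Proof. by move=> vS av; have [] := projT2 (cid (nbr_map_ex v a)) vS av. Qed.

Lemma nbr_map_bary v a t x : in_spine v -> a \in nbr v -> 0 <= t < 1 ->
  Defs.coord x = bary v a t -> Defs.coord (sigma x) = bary (f v) (nbr_map v a) t.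
Proof.
by move=> vS av t01; have [_ _] := projT2 (cid (nbr_map_ex v a)) vS av; apply.
Qed.

Let third01 : 0 <= (3^-1 : R) < 1. Proof. lra. Qed.

Lemma edge_third_pt v a : a \in nbr v ->
  exists x : tree_pt T1, Defs.coord x = bary v a 3^-1 /\ star v x /\ star a x.
Proof.
move=> av; have [|x xE] := @edge_pt R T1 v a 3^-1 av; first lra.
exists x; split=> //; split.
  by apply/(star_bary (nbr_neq av) xE); lra.
by apply/(star_bary_end (nbr_neq av) xE); lra.
Qed.

Lemma nbr_map_inj v a b : in_spine v -> a \in nbr v -> b \in nbr v ->
  nbr_map v a = nbr_map v b -> a = b.
Proof.
move=> vS av bv e; have [x [xE [xv _]]] := edge_third_pt av.
have [y [yE [yv _]]] := edge_third_pt bv.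
have xy : x = y.
  apply: (star_iso_inj iso); [exact: in_spine_stars xv|exact: in_spine_stars yv|].
  apply: geo_ext.
  by rewrite (nbr_map_bary vS av third01 xE) (nbr_map_bary vS bv third01 yE) e.
by have [_] := bary3_inj (nbr_neq av) (nbr_neq bv) (etrans (esym xE) (etrans (congr1 _ xy) yE)).
Qed.

Lemma nbr_map_surj v a' : in_spine v -> a' \in nbr (f v) ->
  exists2 a, a \in nbr v & nbr_map v a = a'.
Proof.
move=> vS a'v; have [|y yE] := @edge_pt R T2 (f v) a' 3^-1 a'v; first lra.
have : star (f v) y by apply/(star_bary (nbr_neq a'v) yE); lra.
rewrite -(star_iso_star iso) // => -[x xv sxy].
have [a [t [av t01 xE]]] := starP (has_nbr v) xv.
exists a => //; have := nbr_map_bary vS av t01 xE; rewrite sxy yE.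
move=> /(bary_inj (nbr_neq a'v) (nbr_neq (nbr_map_nbr vS av))) [_ e].
by rewrite e // invr_eq0 pnatr_eq0.
Qed.

Lemma nbr_map_spine v a : in_spine v -> in_spine a -> a \in nbr v -> nbr_map v a = f a.
Proof.
move=> vS aS av; have [x [xE [xv xa]]] := edge_third_pt av.
have sxE := nbr_map_bary vS av third01 xE.
have fav := star_iso_nbr iso aS vS av.
have [s [_ e]] := star_edge fav (star_iso_in iso vS xv) (star_iso_in iso aS xa).
have [_ {}e] := bary_inj (nbr_neq (nbr_map_nbr vS av)) (nbr_neq fav) (etrans (esym sxE) e).
by apply: e; rewrite invr_eq0 pnatr_eq0.
Qed.

Lemma valence_le2_image v : in_spine v -> (valence v <= 2)%N -> (valence (f v) <= 2)%N.
Proof.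
move=> vS v2; rewrite leqNgt; apply/negP => v'2.
have [w1 w1n _] := valence_gt2 (f v) (f v) v'2.
have [w2 w2n [w21 _]] := valence_gt2 w1 w1 v'2.
have [w3 w3n [w31 w32]] := valence_gt2 w1 w2 v'2.
have [a an aE] := nbr_map_surj vS w1n; have [c cn cE] := nbr_map_surj vS w2n.
have [e en eE] := nbr_map_surj vS w3n.
apply: w32; rewrite -cE -eE; congr nbr_map.
apply: (valence_le2 v2 an en cn).
- by move=> ae; apply: w31; rewrite -aE -eE ae.
- by move=> ac; apply: w21; rewrite -aE -cE ac.
Qed.

(** The line of parents goes to a ray whose valences are eventually at most 2, because [nbr_map] is
    onto; its end is therefore the isolated one. *)
Lemma star_iso_parent v : in_spine v -> f (parent v) = parent (f v).
Proof.
move=> vS; apply: above_parent.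
have rS n : in_spine (iter n parent v) by apply: in_spine_iter.
have [rr ir] := parent_ray v.
have rr' : ray (fun n => f (iter n parent v)).
  apply: reduced_walk_ray => [|n|n /(star_iso_fun_inj iso (rS _) (rS _))].
  - exact: tree_acyclic.
  - by apply: (star_iso_nbr iso (rS n.+1) (rS n)) => /=; apply: parent_nbr.
  - exact: parent_parent.
exists (fun n => f (iter n parent v)); split=> //.
apply/(isolated_endP (@tree_acyclic _ T2) (@valence_neq1 _ T2) rr').
have [n vn] := eventually_valence2 v; exists n => m nm.
by apply: valence_le2_image => //; apply: vn.
Qed.

Definition nbr_rel (v : T1) (v' : T2) := in_spine (parent v) /\ nbr_map (parent v) v = v'.

Lemma nbr_rel_parent v v' : nbr_rel v v' -> parent v' = f (parent v).
Proof.
move=> [wS <-]; apply: (child_nbr (nbr_map_nbr wS (nbr_parent v))).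
rewrite -star_iso_parent // -(nbr_map_spine wS (in_spine_parent wS) (parent_nbr _)).
by move=> /(nbr_map_inj wS (nbr_parent v) (parent_nbr _)) /child_neq_parent.
Qed.

Lemma nbr_rel_spine v : in_spine v -> nbr_rel v (f v).
Proof.
move=> vS; have wS := in_spine_parent vS; split=> //.
by apply: nbr_map_spine => //; apply: nbr_parent.
Qed.

(** The conjugacy at the point 1/3 of the edge gives the images of both ends at once. *)
Lemma return_third v a : in_spine v -> a \in nbr v ->
  let s := return_time v in let s' := return_time (f v) in
  f (iter s (@tmap R T1) v) = iter s' (@tmap R T2) (f v) /\
  nbr_map (iter s (@tmap R T1) v) (iter s (@tmap R T1) a) = iter s' (@tmap R T2) (nbr_map v a).
Proof.
move=> vS av s s'; have [x [xE [xv _]]] := edge_third_pt av.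
have [_ sS _] := return_timeP v.
have sav := iter_tmap_nbr s av.
have := conj_return vS xv => /(congr1 (@Defs.coord _ _)).
rewrite (iter_tree_map_bary _ (nbr_map_bary vS av third01 xE)).
rewrite (nbr_map_bary sS sav third01 (iter_tree_map_bary _ xE)).
apply: bary3_inj; first exact: nbr_neq (nbr_map_nbr sS sav).
by apply: nbr_neq (iter_tmap_nbr _ (nbr_map_nbr vS av)).
Qed.

Lemma star_iso_spine_rel : spine_rel nbr_rel.
Proof.
split.
- by move=> v v' [].
- by move=> v v' Pv; rewrite (nbr_rel_parent Pv); apply: (star_iso_spine iso); case: Pv.
- by move=> v wS; exists (nbr_map (parent v) v).
- move=> v' /(star_iso_fun_surj iso) [w wS fw].
  have v'w : v' \in nbr (f w) by rewrite fw nbr_parent.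
  have [a aw av'] := nbr_map_surj wS v'w.
  have pa : parent a = w.
    apply: (child_nbr aw) => ap.
    apply: (@child_neq_parent _ _ v'); rewrite -fw -star_iso_parent // -av' ap.
    by apply: nbr_map_spine; rewrite ?parent_nbr //; apply: in_spine_parent.
  by exists a; split; rewrite pa.
- by move=> v v1 v2 [_ <-] [_ <-].
- move=> v' v1 v2 P1 P2; have := nbr_rel_parent P1; rewrite (nbr_rel_parent P2).
  case: P1 P2 => w1S e1 [w2S e2] /(star_iso_fun_inj iso w2S w1S) e.
  rewrite -e in w1S e1; apply: (nbr_map_inj w2S); rewrite ?nbr_parent //; last by rewrite e1 e2.
  by rewrite e nbr_parent.
- move=> v v' Pv; split=> [vS|v'S].
    have [_ <-] := Pv; rewrite nbr_map_spine ?nbr_parent //; first exact: (star_iso_spine iso).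
    exact: in_spine_parent.
  have [e eS fe] := star_iso_fun_surj iso v'S.
  have := nbr_rel_parent Pv; rewrite -fe -star_iso_parent // => pe.
  have [wS ew] := Pv.
  have {}pe := star_iso_fun_inj iso (in_spine_parent eS) wS pe.
  have ew' : e \in nbr (parent v) by rewrite -pe nbr_parent.
  suff <- : e = v by [].
  by apply: (nbr_map_inj wS ew' (nbr_parent v)); rewrite nbr_map_spine // fe.
- by move=> v v' Pv; rewrite (nbr_rel_parent Pv); apply: nbr_rel_spine; case: Pv.
- move=> w w' wS [_ <-]; rewrite nbr_map_spine ?nbr_parent //; last exact: in_spine_parent.
  have [<- _] := return_third wS (parent_nbr w); apply: nbr_rel_spine.
  by have [] := return_timeP w.
- move=> v v' Pv; have [wS ev] := Pv.
  rewrite (nbr_rel_parent Pv) -ev -(return_third wS (nbr_parent v)).2.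
  by split; rewrite -iter_tmap_parent //; have [] := return_timeP (parent v).
Qed.

End SpineRel.

(** * The tree isomorphism preserves lengths and the degree *)

Section TreeIso.
Variables (R : realType) (T1 T2 : mptree R) (f : T1 -> T2) (sigma : tree_pt T1 -> tree_pt T2).
Hypothesis iso : star_iso f sigma.
Variables (phi : T1 -> T2).
Hypothesis phi_parent : forall v, phi (parent v) = parent (phi v).
Hypothesis phi_tmap : forall v, phi (tmap v) = tmap (phi v).
Hypothesis phi_rel : forall v v', nbr_rel iso v v' -> phi v = v'.

Lemma phi_spine v : in_spine v -> phi v = f v.
Proof. by move=> vS; apply/phi_rel/nbr_rel_spine. Qed.

Lemma phi_nbr_map v a : in_spine v -> a \in nbr v -> phi a = nbr_map iso v a.
Proof.
move=> vS /nbrP[->|av]; last by subst v; apply: phi_rel.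
rewrite phi_spine ?nbr_map_spine ?parent_nbr //; exact: in_spine_parent.
Qed.

Lemma phi_simplicial : simplicial phi.
Proof.
by move=> u w [->|/nbrP[->|<-]]; [left|right|right]; rewrite // phi_parent ?parent_nbr ?nbr_parent.
Qed.

Lemma phi_sigma (sphi : simplicial phi) v x : in_spine v -> star v x -> sigma x = geo_map sphi x.
Proof.
move=> vS xv; have [a [t [av t01 xE]]] := starP (has_nbr v) xv.
apply: geo_ext; rewrite (coord_geo_map _ xE) (nbr_map_bary iso vS av t01 xE).
by rewrite phi_spine // (phi_nbr_map vS av).
Qed.

Lemma phi_len_spine v : in_spine (parent v) -> 
  len (phi v) (phi (parent v)) = len v (parent v).
Proof.
move=> wS; have vw := nbr_parent v.
rewrite (phi_spine wS) (phi_nbr_map wS vw) len_sym.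
  by rewrite len_nbr_map // len_sym // parent_nbr.
by rewrite nbrC nbr_map_nbr.
Qed.

(** Near infinity [phi] preserves the length of an edge and of its image; their ratio is the degree
    in either tree. *)
Lemma phi_degree : degree T1 = degree T2.
Proof.
have [K K0 KS] := eventually_in_spine T1.
pose v := iter `|K|%N parent (top T1).
have vK : K <= busemann v by rewrite busemann_iter busemann_top; lia.
have N0 := tmap_shift_gt0 T1.
have e1 : len (phi v) (phi (parent v)) = len v (parent v).
  by apply: phi_len_spine; apply: in_spine_parent; apply: KS.
have : len (phi (tmap v)) (phi (parent (tmap v))) = len (tmap v) (parent (tmap v)).
  by apply: phi_len_spine; apply: in_spine_parent; apply: KS; rewrite busemann_tmap; lia.
rewrite -tmap_parent !phi_tmap !len_tmap ?phi_parent ?parent_nbr //.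
rewrite -phi_parent e1 => /(mulIf (lt0r_neq0 (len_gt0 (parent_nbr v)))) /eqP.
by rewrite eqr_nat => /eqP.
Qed.

(** Descending induction: the length above [v] is the one above [tmap v], divided by the common
    degree. *)
Lemma phi_len v : len (phi v) (phi (parent v)) = len v (parent v).
Proof.
have [K K0 KS] := eventually_in_spine T1; have N0 := tmap_shift_gt0 T1.
suff main n : forall v, K - n%:Z <= busemann v -> len (phi v) (phi (parent v)) = len v (parent v).
  apply: (main `|K - busemann v|%N); lia.
elim: n => [|n IH] {}v vn.
  by apply: phi_len_spine; apply: in_spine_parent; apply: KS; lia.
have := IH (tmap v); rewrite -tmap_parent !phi_tmap !len_tmap ?phi_parent ?parent_nbr //.
rewrite -phi_parent -phi_degree busemann_tmap => e.
have d0 : (degree T1)%:R != 0 :> R by rewrite pnatr_eq0; have := degree_gt1 T1; lia.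
by apply: (mulfI d0); apply: e; lia.
Qed.

Lemma phi_len_nbr v w : w \in nbr v -> len (phi v) (phi w) = len v w.
Proof.
move=> /nbrP[->|<-]; first exact: phi_len.
by rewrite len_sym ?phi_len 1?len_sym ?phi_parent ?nbr_parent ?parent_nbr.
Qed.

End TreeIso.

(** * Local models off the spine *)

Section Model.
Variables (R : realType) (T : mptree R) (M : tree_of_local_models T).
Implicit Types (v w : T).

Lemma marking_in_star v (p : model M v) : star v (marking p).
Proof. by rewrite -(marking_star M); exists p. Qed.

Lemma model_inhabited v : exists p : model M v, True.
Proof.
have [x xE] := vertex_pt v.
have : star v x by rewrite /star /= xE bary0 eqxx.
by rewrite -(marking_star M) => -[p]; exists p.
Qed.

Lemma iter_tree_map_star_inj n v x y : (forall i, (i < n)%N -> ~ in_spine (iter i (@tmap R T) v)) ->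
  star v x -> star v y -> iter n (@tree_map R T) x = iter n (@tree_map R T) y -> x = y.
Proof.
move=> nS xv yv e; have [a [t [av t01 xE]]] := starP (has_nbr v) xv.
have [b [s [bv s01 yE]]] := starP (has_nbr v) yv.
have := congr1 (@Defs.coord _ _) e.
rewrite (iter_tree_map_bary _ xE) (iter_tree_map_bary _ yE).
move=> /(bary_inj (nbr_neq (iter_tmap_nbr n av)) (nbr_neq (iter_tmap_nbr n bv))) [ts ab].
apply: geo_ext; rewrite xE yE -ts; have [->|t0] := eqVneq t 0; first by rewrite !bary0.
by rewrite (iter_tmap_nbr_inj nS av bv (ab t0)).
Qed.

Lemma fiber_count1 (X Y : surface R) (h : X -> Y) (A : set X) y : fiber_count h A y 1 ->
  exists2 x, mult_at h x 1 & forall x', A x' -> h x' = y -> x' = x.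
Proof.
move=> [s [m [us sE ms sm]]]; case: s us sE ms sm => [|x s] us sE ms.
  by rewrite big_nil.
have mx := ms x (mem_head x s).
rewrite big_cons; case: s us sE ms => [|x' s] us sE ms.
  rewrite big_nil addn0 => m1; rewrite m1 in mx.
  by exists x => // x' Ax' hx'; have := (sE x').2 (conj Ax' hx'); rewrite inE => /eqP.
have [m0 _] := mx; have [m0' _] := ms x' ltac:(by rewrite !inE eqxx orbT).
by rewrite big_cons; lia.
Qed.

Lemma leaf_refl (X : local_model R) (p : X) : leaf p p.
Proof. exact: connected_component_refl. Qed.

(** Off the spine all local degrees are 1, so the map is injective with multiplicity 1 on each leaf.
    Two points with equal image have equal markings, by injectivity on the star, hence lie on one
    leaf. *)
Lemma model_map_isometry v : ~ in_spine v ->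
  holo_isometry (lm_form (model M v)) (lm_form (model M (tmap v))) (@model_map _ _ M v).
Proof.
move=> vS.
have vd : vdeg v = 1%N.
  by have := vdeg_gt0 v; have := vS; rewrite in_spineP; lia.
have fib (p : model M v) : fiber_count (@model_map _ _ M v) (leaf p) (model_map p) 1.
  have [w [t [wv t01 xE]]] := starP (has_nbr v) (marking_in_star p).
  have [t0|t0] := eqVneq t 0.
    rewrite -vd; apply: model_map_vdeg; rewrite /is_vertex xE t0 bary0 eqxx //.
  have <- : edeg v w = 1%N.
    by have := edeg_gt0 wv; have := edeg_le_vdeg wv; rewrite vd; lia.
  apply: model_map_edeg => //; apply/(star_bary_end (nbr_neq wv) xE).
  by rewrite lt_neqAle eq_sym t0; lra.
have uniq_pt p : exists2 x, mult_at (@model_map _ _ M v) x 1 &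
  forall x', leaf p x' -> model_map x' = model_map p -> x' = x by exact: fiber_count1 (fib p).
apply: local_model_map_isometry; first exact: model_map_local.
- move=> p p' e; have [x _ xu] := uniq_pt p.
  transitivity x; first by apply: xu => //; apply: leaf_refl.
  apply/esym/xu => //; apply/marking_leaf.
  apply: (@iter_tree_map_star_inj 1 v); rewrite /= -?model_map_marking ?e //.
  + by case.
  + exact: marking_in_star.
  + exact: marking_in_star.
- move=> p; have [x mx xu] := uniq_pt p.
  by have -> : p = x by apply: xu => //; apply: leaf_refl.
Qed.

Definition over_pt v (p : model M v) : Defs.total M := existT _ v p.

Lemma iter_total_map n v : (forall i, (i < n)%N -> ~ in_spine (iter i (@tmap R T) v)) ->
  exists k : model M v -> model M (iter n (@tmap R T) v),
    holo_isometry (lm_form (model M v)) (lm_form (model M (iter n (@tmap R T) v))) k /\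
    forall p, iter n (@total_map _ _ M) (over_pt p) = over_pt (k p).
Proof.
elim: n => [|n IH] nS.
  by exists id; split=> //; apply: holo_isometry_id.
have [|k [kiso kE]] := IH; first by move=> i ni; apply: nS; lia.
exists (fun p => model_map (k p)); split=> [|p]; last by rewrite /= kE.
exact: (holo_isometry_comp kiso (model_map_isometry (nS n (ltnSn n)))).
Qed.

Lemma total_marking_iter n p :
  total_marking (iter n (@total_map _ _ M) p) = iter n (@tree_map R T) (total_marking p).
Proof.
elim: n => [//|n IH]; rewrite /= -IH /total_marking /=; exact: model_map_marking.
Qed.

Lemma tag_iter n p : tag (iter n (@total_map _ _ M) p) = iter n (@tmap R T) (tag p).
Proof. by elim: n => [//|n IH] /=; rewrite IH. Qed.

Lemma iter_total_map_inj n p q : tag p = tag q ->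
  (forall i, (i < n)%N -> ~ in_spine (iter i (@tmap R T) (tag p))) ->
  iter n (@total_map _ _ M) p = iter n (@total_map _ _ M) q -> p = q.
Proof.
case: p q => [v p] [w q] /= vw; subst w => nS.
have [k [[[l [kK _ _ _]] _] kE]] := iter_total_map nS.
rewrite -!/(over_pt _) !kE => e; congr over_pt; apply: (can_inj kK).
exact: eq_from_Tagged e.
Qed.

(** The hitting time of the spine, 0 on it, whereas [return_time] is always positive: it is one more
    than the hitting time of the image. *)
Definition spine_time v := if `[< in_spine v >] then 0%N else return_time v.

Lemma spine_timeP v : in_spine (iter (spine_time v) (@tmap R T) v) /\
  forall i, (i < spine_time v)%N -> ~ in_spine (iter i (@tmap R T) v).
Proof.
rewrite /spine_time; case: asboolP => vS; first by split.
have [_ rS rmin] := return_timeP v; split=> // -[//|i] ir.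
exact: rmin.
Qed.

Lemma spine_time0 v : in_spine v -> spine_time v = 0%N.
Proof. by move=> vS; rewrite /spine_time ifT //; apply/asboolP. Qed.

Lemma return_time_spine_time v : return_time v = (spine_time (tmap v)).+1.
Proof.
have [sS smin] := spine_timeP (tmap v).
apply: return_timeE => //; first by rewrite iterSr.
by move=> [//|i] /= ir; rewrite -iterS iterSr; apply: smin.
Qed.

Lemma spine_time_nonspine v : ~ in_spine v -> spine_time v = (spine_time (tmap v)).+1.
Proof.
by move=> vS; rewrite -return_time_spine_time /spine_time ifF //; apply/asboolPn.
Qed.

End Model.

(** * Equivalence *)

Section GeoIso.
Variables (R : realType) (T1 T2 : mptree R) (phi : T1 -> T2) (psi : T2 -> T1).
Hypotheses (sphi : simplicial phi) (spsi : simplicial psi).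
Hypotheses (phiK : cancel phi psi).

Lemma geo_map_can (x : tree_pt T1) : geo_map spsi (geo_map sphi x) = x.
Proof.
have [u [w [t [_ _ xE]]]] := coordP x; apply: geo_ext.
by rewrite (coord_geo_map _ (coord_geo_map _ xE)) !phiK xE.
Qed.

Hypothesis phi_nbr : forall v w, w \in nbr v -> phi w \in nbr (phi v).
Hypothesis phi_len : forall v w, w \in nbr v -> len (phi v) (phi w) = len v w.

Lemma geo_map_chain x y l : chain (edge_metric_step (len (m := T1))) x y l ->
  chain (edge_metric_step (len (m := T2))) (geo_map sphi x) (geo_map sphi y) l.
Proof.
elim=> [z|{}x {}y z c {}l st _ IH]; first exact: chain_nil.
apply: chain_cons IH; move: st => [u [w [t [s [wu [_ t01 xE] [_ s01 yE] ->]]]]].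
have on (z' : tree_pt T1) r : Defs.coord z' = bary u w r -> 0 <= r <= 1 ->
    on_simplex (phi u) (phi w) r (geo_map sphi z').
  by move=> z'E r01; split=> //; [right; exact: phi_nbr|exact: coord_geo_map].
exists (phi u), (phi w), t, s; rewrite phi_len //.
by split; [exact: phi_nbr|exact: on|exact: on|].
Qed.

End GeoIso.

Section SpineIsomorphism.
Variables (R : realType) (T1 T2 : mptree R).
Variables (M1 : tree_of_local_models T1) (M2 : tree_of_local_models T2).
Variables (i : Defs.total M1 -> Defs.total M2) (sigma : tree_pt T1 -> tree_pt T2).
Hypothesis i_iso : total_isometry (@in_spine R T1) (@in_spine R T2) i.
Hypothesis i_return : forall p, Defs.over (@in_spine R T1) p ->
  first_return (i p) = i (first_return p).
Hypothesis sigma_bij : set_bij (@spine_stars R T1) (@spine_stars R T2) sigma.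
Hypothesis sigma_dist : forall x y, spine_stars x -> spine_stars y ->
  tree_dist (sigma x) (sigma y) = tree_dist x y.
Hypothesis sigma_marking : forall p, Defs.over (@in_spine R T1) p ->
  total_marking (i p) = sigma (total_marking p).

Lemma spine_fun : exists f : T1 -> T2, forall v, in_spine v ->
  exists g : model M1 v -> model M2 (f v),
    holo_isometry (lm_form (model M1 v)) (lm_form (model M2 (f v))) g /\
    forall p : model M1 v, i (over_pt p) = over_pt (g p).
Proof.
have /choice[f fP] v : exists w, in_spine v -> exists g : model M1 v -> model M2 w,
    holo_isometry (lm_form (model M1 v)) (lm_form (model M2 w)) g /\
    forall p : model M1 v, i (over_pt p) = over_pt (g p).
  have [vS|nS] := pselect (in_spine v); last by exists (top T2).
  by have [w [g [gi ig]]] := i_iso.2 v vS; exists w => _; exists g.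
by exists f.
Qed.

Section F.
Variable f : T1 -> T2.
Hypothesis fP : forall v, in_spine v -> exists g : model M1 v -> model M2 (f v),
    holo_isometry (lm_form (model M1 v)) (lm_form (model M2 (f v))) g /\
    forall p : model M1 v, i (over_pt p) = over_pt (g p).

Lemma tag_spine p : in_spine (tag p) -> tag (i p) = f (tag p).
Proof. by case: p => v p /= /fP [g [_ ig]]; rewrite -/(over_pt p) ig. Qed.

Lemma total_marking_in_star (T : mptree R) (M : tree_of_local_models T) (p : Defs.total M) :
  star (tag p) (total_marking p).
Proof. exact: marking_in_star. Qed.

(** [i] maps each model over the spine onto a whole model, so injectivity of [i] passes to [f].
    Markings map models onto stars, which transfers the rest to [sigma]. *)
Lemma spine_star_iso : star_iso f sigma.
Proof.
have [[iS iinj isurj] _] := i_iso.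
have [sS sinj _] := sigma_bij.
have spineS v : in_spine v -> in_spine (f v).
  move=> vS; have [p _] := model_inhabited M1 v.
  by have := iS (over_pt p) vS; rewrite /Defs.over /= tag_spine.
have liftf v (q : model M2 (f v)) : in_spine v -> exists p : model M1 v, i (over_pt p) = over_pt q.
  move=> /fP [g [[[h [_ hK _ _]] _] ig]]; exists (h q).
  by rewrite ig hK.
split=> //.
- move=> u v uS vS fuv; have [p _] := model_inhabited M1 u.
  have /= tp : tag (i (over_pt p)) = f v by rewrite tag_spine.
  case E : (i (over_pt p)) tp => [w q] /= wE; subst w.
  have [p' ip'] := liftf v q vS.
  have := iinj (over_pt p) (over_pt p'); rewrite !inE => /(_ uS vS).
  by rewrite E ip' => /(_ erefl) /(congr1 tag).
- move=> v' v'S; have [q _] := model_inhabited M2 v'.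
  have [p pS ip] := isurj (over_pt q) v'S.
  by exists (tag p) => //; rewrite -tag_spine // ip.
- move=> v vS; apply/seteqP; split=> [y [x xv <-]|y yv].
    move: xv; rewrite -(marking_star M1) => -[p _ <-].
    have := sigma_marking (p := over_pt p) vS; rewrite {2}/total_marking /= => <-.
    by rewrite -(tag_spine (p := over_pt p) vS); apply: total_marking_in_star.
  move: yv; rewrite -(marking_star M2) => -[q _ <-].
  have [p ip] := liftf v q vS; exists (marking p); first exact: marking_in_star.
  by have := sigma_marking (p := over_pt p) vS; rewrite ip.
- by move=> x y xS yS; apply: sinj; rewrite inE.
Qed.

Lemma spine_conj_return w x : in_spine w -> star w x ->
  sigma (iter (return_time w) (@tree_map R T1) x) =
  iter (return_time (f w)) (@tree_map R T2) (sigma x).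
Proof.
move=> wS; rewrite -(marking_star M1) => -[p _ <-].
have [_ rS _] := return_timeP w.
have := i_return (p := over_pt p) wS; rewrite /first_return tag_spine //= => e.
rewrite -[marking p]/(total_marking (over_pt p)) -total_marking_iter -sigma_marking.
  by rewrite -e total_marking_iter sigma_marking.
by rewrite /Defs.over /= tag_iter.
Qed.

End F.

Lemma spine_isomorphism_equivalent : equivalent M1 M2.
Proof.
have [f fP] := spine_fun.
have iso := spine_star_iso fP; have conj_ret := spine_conj_return fP.
have [phi [psi [phiK psiK phi_rel phiS phi_tmap]]] := spine_rel_extend (star_iso_spine_rel iso conj_ret).
have phi_parent v : phi (parent v) = parent (phi v) by have [] := phiS v.
have {}phiS v : in_spine v <-> in_spine (phi v) by have [] := phiS v.
have sphi := phi_simplicial phi_parent.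
have phi_f v : in_spine v -> phi v = f v by exact: (phi_spine phi_rel).
have phi_iter n v : phi (iter n (@tmap R T1) v) = iter n (@tmap R T2) (phi v).
  by elim: n => [//|n IH] /=; rewrite phi_tmap IH.
have phi_time v n : (n < spine_time v)%N -> ~ in_spine (iter n (@tmap R T2) (phi v)).
  by move=> nv; rewrite -phi_iter -phiS; apply: (spine_timeP v).2.
have lift v : exists g : model M1 v -> model M2 (phi v),
    holo_isometry (lm_form (model M1 v)) (lm_form (model M2 (phi v))) g /\
    forall p : model M1 v, iter (spine_time v) (@total_map _ _ M2) (over_pt (g p)) =
      i (iter (spine_time v) (@total_map _ _ M1) (over_pt p)).
  have [sS smin] := spine_timeP v.
  have [k1 [k1iso k1E]] := iter_total_map M1 smin.
  have [k2 [k2iso k2E]] := iter_total_map M2 (phi_time v).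
  have [g [giso gE]] := fP _ sS.
  have [[l [k2K lK _ _]] _] := k2iso.
  have liso := holo_isometry_inv k2K lK k2iso.
  have e : iter (spine_time v) (@tmap R T2) (phi v) = f (iter (spine_time v) (@tmap R T1) v).
    by rewrite -phi_iter phi_f.
  (* The maps are generalized so that the target in their types can be rewritten as the model over
     the image by [f]. *)
  move: k2 l k2K lK k2iso liso k2E; rewrite e => k2 l k2K lK k2iso liso k2E.
  exists (l \o g \o k1); split.
    exact: (holo_isometry_comp k1iso (holo_isometry_comp giso liso)).
  by move=> p; rewrite k2E /= lK k1E gE.
pose g v := projT1 (cid (lift v)).
have giso v : holo_isometry (lm_form (model M1 v)) (lm_form (model M2 (phi v))) (g v).
  exact: (projT2 (cid (lift v))).1.
have gE v (p : model M1 v) : iter (spine_time v) (@total_map _ _ M2) (over_pt (g v p)) =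
      i (iter (spine_time v) (@total_map _ _ M1) (over_pt p)).
  exact: (projT2 (cid (lift v))).2.
pose I (p : Defs.total M1) : Defs.total M2 := over_pt (g (tag p) (tagged p)).
have IE p : iter (spine_time (tag p)) (@total_map _ _ M2) (I p) =
      i (iter (spine_time (tag p)) (@total_map _ _ M1) p).
  by case: p => v p; apply: gE.
have I_spine p : in_spine (tag p) -> I p = i p.
  by move=> pS; have := IE p; rewrite spine_time0.
have psi_parent v : psi (parent v) = parent (psi v).
  by rewrite -[v in LHS]psiK -phi_parent phiK.
have spsi := phi_simplicial psi_parent.
have phi_nbr v w : w \in nbr v -> phi w \in nbr (phi v).
  by move=> /nbrP[->|<-]; rewrite phi_parent ?parent_nbr ?nbr_parent.
have psi_nbr v w : w \in nbr v -> psi w \in nbr (psi v).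
  by move=> /nbrP[->|<-]; rewrite psi_parent ?parent_nbr ?nbr_parent.
have phi_ln := phi_len_nbr phi_parent phi_tmap phi_rel.
have psi_ln v w : w \in nbr v -> len (psi v) (psi w) = len v w.
  by move=> wv; rewrite -phi_ln ?psi_nbr // !psiK.
have conj_geo n x : geo_map sphi (iter n (@tree_map R T1) x) =
    iter n (@tree_map R T2) (geo_map sphi x).
  have [u [w [t [_ _ xE]]]] := coordP x; apply: geo_ext.
  rewrite (coord_geo_map _ (iter_tree_map_bary n xE)).
  by rewrite (iter_tree_map_bary n (coord_geo_map _ xE)) !phi_iter.
exists I; split.
- split; last by move=> v _; exists (phi v), (g v).
  split=> //.
  + move=> [v p] [w q] _ _ e; have /(can_inj phiK) vw : phi v = phi w := congr1 tag e.
    subst w; have [[h [gK _ _ _]] _] := giso v.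
    by congr over_pt; apply: (can_inj gK); apply: eq_from_Tagged e.
  + move=> [v' q] _; rewrite -(psiK v') in q *.
    have [[h [_ hK _ _]] _] := giso (psi v').
    by exists (over_pt (h q)) => //; rewrite /I /= hK.
(* Both sides lie over [phi (tmap (tag p))], where iteration up to the spine is injective, so they
   are compared after it. For [p] off the spine this is the relation [IE] defining [I]; in the spine
   it is the conjugacy of first returns. *)
- move=> p; apply: (@iter_total_map_inj _ _ _ (spine_time (tmap (tag p)))) => /=.
  + by rewrite phi_tmap.
  + by rewrite -phi_tmap; apply: phi_time.
  rewrite (IE (total_map p)) -!iterSr.
  have [pS|nS] := pselect (in_spine (tag p)); last first.
    by rewrite -spine_time_nonspine // IE.
  rewrite I_spine // -return_time_spine_time -[RHS]i_return //.
  rewrite /first_return (tag_spine fP) //; congr iter; apply/esym.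
  have [r0 rS rmin] := return_timeP (tag p).
  rewrite -phi_f //; apply: return_timeE => //; first by rewrite -phi_iter -phiS.
  by move=> n nr; rewrite -phi_iter -phiS; apply: rmin.
exists (geo_map sphi); split.
- by exists (geo_map spsi); apply: geo_map_can.
(* [phi] and [psi] transport chains with their lengths, so the two infima are over the same set. *)
- move=> x y; rewrite /tree_dist /chain_dist; congr inf; apply/seteqP; split=> l.
    move=> /(geo_map_chain spsi psi_nbr psi_ln).
    by rewrite !geo_map_can.
  exact: geo_map_chain.
(* Both points lie in the star of [phi (tag p)], on which iteration up to the spine is injective;
   there [phi] and [sigma] agree. *)
- move=> p; apply: (@iter_tree_map_star_inj _ _ (spine_time (tag p)) (phi (tag p))).
  + exact: phi_time.
  + exact: (total_marking_in_star (I p)).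
  + have [a [t [av t01 xE]]] := starP (has_nbr (tag p)) (total_marking_in_star p).
    apply/(star_bary _ (coord_geo_map sphi xE)); last by lra.
    exact: nbr_neq (phi_nbr _ _ av).
  rewrite -conj_geo -!total_marking_iter IE.
  have [sS _] := spine_timeP (tag p).
  rewrite sigma_marking; last by rewrite /Defs.over /= tag_iter.
  apply: (phi_sigma phi_rel sphi sS).
  by rewrite -tag_iter; apply: total_marking_in_star.
- by move=> x; apply/esym; apply: (conj_geo 1%N x).
Qed.

End SpineIsomorphism.

Theorem proposition4p2 (R : realType) (T1 T2 : mptree R)
    (M1 : tree_of_local_models T1) (M2 : tree_of_local_models T2)
    (spine_iso : spine_isomorphic M1 M2) : equivalent M1 M2.
Proof.
have [i [i_iso i_ret [sigma [sbij sdist smark]]]] := spine_iso.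
exact: (spine_isomorphism_equivalent i_iso i_ret sbij sdist smark).
Qed.
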